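(* Consider online combinatorial optimization with semi-bandit feedback over $T$ rounds with decision set $\mathcal{S}\subseteq\{0,1\}^d$ satisfying $\|\boldsymbol v\|_1\le m$ for all $\boldsymbol v\in\mathcal S$, against a non-oblivious environment. Fix an arbitrary $\delta\in(0,1)$. For every $\eta>0$, $\beta>0$ and positive integer $M$, with probability at least $1-\delta$, the regret of the algorithm FPL+GR.P run with parameters $\eta,\beta,M$ satisfies $$\begin{aligned}R_T\le{}&\frac{m(\log(d/m)+1)}{\eta}+\eta\left(Mm\sqrt{2T\log\tfrac5\delta}+2md\sqrt{T\log\tfrac5\delta}+2mdT\right)+\frac{dT}{eM}\\&+\beta\left(M\sqrt{2mT\log\tfrac5\delta}+2d\sqrt{T\log\tfrac5\delta}+2dT\right)+\frac{m\log(5d/\delta)}{\beta}\\&+m\sqrt{2(e-2)T}\,\log\tfrac5\delta+\sqrt{8T\log\tfrac5\delta}+\sqrt{2(e-2)T}.\end{aligned}$$ In particular, with $$M=\left\lceil\sqrt{\frac{dT}{m}}\right\rceil,\qquad \beta=\sqrt{\frac{m}{dT}},\qquad \eta=\sqrt{\frac{\log(d/m)+1}{dT}},$$ the regret of FPL+GR.P is bounded as $$\begin{aligned}R_T\le{}&3m\sqrt{dT\left(\log\tfrac dm+1\right)}+\sqrt{mdT}\left(\log\tfrac{5d}\delta+2\right)+\sqrt{2mT\log\tfrac5\delta}\left(\sqrt{\log\tfrac dm+1}+1\right)\\&+1.2\,m\sqrt T\log\tfrac5\delta+\sqrt T\left(\sqrt{8\log\tfrac5\delta}+1.2\right)+2\sqrt{d\log\tfrac5\delta}\left(m\sqrt{\log\tfrac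 dm+1}+\sqrt m\right)\end{aligned}$$ with probability at least $1-\delta$.
   Context: **Problem.** Let $1\le m\le d$ and $T\ge1$ be integers and let $\mathcal S\subseteq\{0,1\}^d$ be a nonempty finite set with $\|\boldsymbol v\|_1\le m$ for all $\boldsymbol v\in\mathcal S$. In each round $t=1,\dots,T$ the learner draws a random action $\boldsymbol V_t\in\mathcal S$, the environment chooses a loss vector $\boldsymbol\ell_t\in[0,1]^d$, and the learner suffers loss $\boldsymbol V_t^{\mathsf T}\boldsymbol\ell_t$. The environment is non-oblivious: $\boldsymbol\ell_t$ may depend in an arbitrary fashion on the previous actions $\boldsymbol V_1,\dots,\boldsymbol V_{t-1}$ (but not on the learner's randomness in round $t$). Semi-bandit feedback: the learner observes $\ell_{t,i}$ only for those $i$ with $V_{t,i}=1$. **Regret.** $R_T=\max_{\boldsymbol v\in\mathcal S}\sum_{t=1}^T(\boldsymbol V_t-\boldsymbol v)^{\mathsf T}\boldsymbol\ell_t$ (a random variable). **Algorithm FPL+GR.P with parameters $\eta>0$, $\beta>0$, $M\in\{1,2,\dots\}$.** Start with $\widetilde{\boldsymbol L}_0=\boldsymbol 0\in\mathbb R^d$. In round $t$: 1. Draw $\boldsymbol Z_t\in\mathbb R^d$, independent of the past, with i.i.d. standard (unit mean) exponential components, and play $\boldsymbol V_t=\arg\min_{\boldsymbol v\in\mathcal S}\boldsymbol v^{\mathsf T}(\eta\widetilde{\boldsymbol L}_{t-1}-\boldsymbol Z_t)$ (the minimizer is almost surely unique). 2. (Geometric Resampling) For $k=1,\dots,M$ draw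 fresh independent copies $\boldsymbol Z_t'(k)$ of $\boldsymbol Z_t$ and set $\boldsymbol V_t'(k)=\arg\min_{\boldsymbol v\in\mathcal S}\boldsymbol v^{\mathsf T}(\eta\widetilde{\boldsymbol L}_{t-1}-\boldsymbol Z'_t(k))$. For $i=1,\dots,d$ let $K_{t,i}=\min\big(\{k\in\{1,\dots,M\}: V'_{t,i}(k)=1\}\cup\{M\}\big)$. 3. Set $\widehat\ell_{t,i}=K_{t,i}V_{t,i}\ell_{t,i}$ and $\widetilde\ell_{t,i}=\frac1\beta\log(1+\beta\widehat\ell_{t,i})$ for all $i$, and $\widetilde{\boldsymbol L}_t=\widetilde{\boldsymbol L}_{t-1}+\widetilde{\boldsymbol\ell}_t$. *)

(* Defs.v *)
From HB Require Import structures.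
From mathcomp Require Import all_boot all_order all_algebra.
From mathcomp Require Import all_classical all_reals all_analysis.

Set Implicit Arguments.
Unset Strict Implicit.
Unset Printing Implicit Defensive.

Import Order.TTheory GRing.Theory Num.Theory.
Import numFieldNormedType.Exports.

Local Open Scope classical_set_scope.
Local Open Scope ring_scope.

(** Mutual independence of a finite family of set systems (here, sigma-algebras):
    the product rule for every subfamily [J]. *)
Definition mutually_independent {dO : measure_display}
    {Omega : measurableType dO} {R : realType} (P : probability Omega R)
    {I : finType} (F : I -> set (set Omega)) : Prop :=
  forall (J : {set I}) (A : I -> set Omega),
    (forall i, i \in J -> F i (A i)) ->
    P (\bigcap_(i in [set` J]) A i) = (\prod_(i in J) P (A i))%E.

(** The sigma-algebra generated by [X]. *)
Definition sigma_of {dO dY : measure_display} {Omega : measurableType dO}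
    {Y : measurableType dY} (X : Omega -> Y) : set (set Omega) :=
  preimage_set_system setT X measurable.

(** Elements of {0,1}^d. *)
Notation action d := {ffun 'I_d -> bool}.

Definition dotp {R : realType} {d : nat} (v : action d) (x : 'I_d -> R) : R :=
  \sum_(i < d) (v i)%:R * x i.

(** An element of [S]; the zero action is only a default for [S = set0]. *)
Definition some_action {d : nat} (S : {set action d}) : action d :=
  odflt [ffun=> false] [pick v in S].

(** A minimizer of [v |-> v^T x] over nonempty [S], with ties broken by the
    enumeration order of the actions. *)
Definition argmin_action {R : realType} {d : nat} (S : {set action d})
    (x : 'I_d -> R) : action d :=
  [arg min_(v < some_action S in S) dotp v x]%O.

(** min ({ k in {1..M} | b_k } U {M}), the k-th resampling being [k.-1 : 'I_M]. *)
Definition resampling_count {M : nat} (b : 'I_M -> bool) : nat :=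
  \big[minn/M]_(k < M | b k) k.+1.

Section FPL_GR_P.
Context {R : realType} {d M : nat}.
Variables (S : {set action d}) (eta beta : R).
(* [env h] is the loss vector chosen after the past actions [h], listed in
   chronological order; the current round is [size h]. *)
Variable env : seq (action d) -> 'I_d -> R.
(* A realization of the learner's randomness. Rounds are numbered from 0:
   [z t None] is the perturbation Z_(t+1) used to play and [z t (Some k)] is the
   resampled copy Z'_(t+1)(k+1). *)
Variable z : nat -> option 'I_M -> 'I_d -> R.

Definition fpl_action (L : 'I_d -> R) (x : 'I_d -> R) : action d :=
  argmin_action S (fun i => eta * L i - x i).

(** After [t] rounds: the actions played so far and the cumulative loss
    estimates. The update reads [ell i] only through [(V i)%:R * ell i], i.e.
    uses only the semi-bandit feedback. *)
Fixpoint fpl_state (t : nat) : seq (action d) * ('I_d -> R) :=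
  if t is s.+1 then
    let: (h, L) := fpl_state s in
    let ell := env h in
    let V := fpl_action L (z s None) in
    let K i := resampling_count (fun k => fpl_action L (z s (Some k)) i) in
    let ellhat i := (K i)%:R * (V i)%:R * ell i in
    (rcons h V, fun i => L i + beta^-1 * ln (1 + beta * ellhat i))
  else ([::], fun=> 0).

Definition played_action (t : nat) : action d :=
  fpl_action (fpl_state t).2 (z t None).

Definition suffered_loss (t : nat) : 'I_d -> R := env (fpl_state t).1.

Definition regret_against (T : nat) (v : action d) : R :=
  \sum_(t < T) \sum_(i < d)
    ((played_action t i)%:R - (v i)%:R) * suffered_loss t i.

(** The maximum over nonempty [S]; the base value is itself one of the terms. *)
Definition regret (T : nat) : R :=
  \big[Num.max/regret_against T (some_action S)]_(v in S) regret_against T v.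

End FPL_GR_P.

(* Main.v *)
Require Import Defs.
From HB Require Import structures.
From mathcomp Require Import all_boot all_order all_algebra.
From mathcomp Require Import ring lra.
From mathcomp Require Import all_classical all_reals all_analysis measurable_realfun.

Set Implicit Arguments.
Unset Strict Implicit.
Unset Printing Implicit Defensive.

Import Order.TTheory GRing.Theory Num.Theory.
Import numFieldNormedType.Exports.

Local Open Scope classical_set_scope.
Local Open Scope ring_scope.

(** Let [p_t] be the law of [V_t] given the past, [q_t] its mean, [l^_t] the
    importance-weighted loss estimates and [l~_t] their logarithmic versions,
    and put [B_t = sum_u p_t(u) exp(- eta u.l~_t) u.l~_t]. The regret against
    [v] is the sum of three terms.

    - [sum_t B_t - v.L~_T]: since the exponential law is memoryless,
      [p_t(u) exp(- eta u.l~_t) <= p_(t+1)(u)], so this is at most the loss of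
      the "be the leader" strategy, hence at most
      [m (ln (d / m) + 1) / eta] surely.
    - [v.(L~_T - L_T)]: for each [i], [exp (beta (L~_(t,i) - L_(t,i)))] is a
      supermartingale, because [1 + beta l^_i] has conditional mean at most
      [exp (beta l_i)].
    - [sum_t (V_t.l_t - B_t)]: because [B_t >= 0], the increment [X_t] is at
      most [m], however large the estimates are. Its conditional mean is at
      most [d / (e M) + beta d + 2 eta m d], its second moment at most [3 m^2],
      and a single exponential supermartingale with tilt
      [1 / (m sqrt (2 (e - 2) T))] controls the sum when [T >= 3];
      for [T <= 2] the bound exceeds the trivial regret [m T].

    The failure probabilities are [d * (delta / (5 d))] and [4 delta / 5]. The
    resulting bound is smaller than both bounds of the theorem: no deviation
    term involves [M], and [2 beta d T] is improved to [beta d T]; the tuned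
    bound uses this gain to absorb [d T / (e M)]. *)

(** * Numerical bounds on the exponential *)

(** The environment reacts to the actions played, yet the first term is bounded surely: [p_t]
    depends on the past only through the current estimates, so along a frozen path all these laws
    can be realized by one auxiliary perturbation vector, shared by the rounds and integrated out.
    For the other two terms no conditional expectation is formed: a round is integrated over a
    second sample point, independent of the past, and for a frozen past its [M + 1] actions follow a
    finite product law, so moments are finite sums.

    The constants are linked. By [exp x <= 1 + x + 0.65 x^2] for [x <= 0.49], the second moment
    [3 m^2] costs [1.95 (lam m)^2] per round, where [lam] is the tilt; over [T] rounds this is
    [1.95 / (2 (e - 2))], just below [ln 4]. The threshold [ln (5 d / delta)] per coordinate leaves
    [4 delta / 5] for the third term, and the gain [ln 4] over a budget of [delta / 5] covers that
    cost. The condition [x <= 0.49] holds from [T = 3] on. *)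

Section exponential_bounds.
Context {R : realType}.
Implicit Types x : R.

(** The difference of the two sides has derivative [exp y - (1 + y) >= 0] and vanishes at 0. The
    cubic bound repeats the argument one order higher. *)
Lemma expR_le_taylor2 x : x <= 0 -> expR x <= 1 + x + x ^+ 2 / 2.
Proof.
rewrite le_eqVlt => /predU1P[->|x0]; first by rewrite expR0; lra.
pose f (y : R) := expR y - (1 + y + y ^+ 2 / 2).
have df (y : R) : is_derive y 1 f (expR y - (1 + y)).
  by apply: is_derive_eq; rewrite /GRing.scale/=; field.
have [|c _] := @MVT R f _ x 0 x0 (fun y _ => df y).
  by apply: derivable_within_continuous => y _; exact: ex_derive.
rewrite /f expR0 sub0r => h.
have : 0 <= (expR c - (1 + c)) * - x.
  by rewrite mulr_ge0 ?subr_ge0 ?expR_ge1Dx// oppr_cp0 ltW.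
by rewrite -h; lra.
Qed.

Lemma expR_ge_taylor3 x :
  x <= 0 -> 1 + x + x ^+ 2 / 2 + x ^+ 3 / 6 <= expR x.
Proof.
rewrite le_eqVlt => /predU1P[->|x0]; first by rewrite expR0; lra.
pose f (y : R) := expR y - (1 + y + y ^+ 2 / 2 + y ^+ 3 / 6).
have df (y : R) : is_derive y 1 f (expR y - (1 + y + y ^+ 2 / 2)).
  by apply: is_derive_eq; rewrite /GRing.scale/=; field.
have [|c cx] := @MVT R f _ x 0 x0 (fun y _ => df y).
  by apply: derivable_within_continuous => y _; exact: ex_derive.
rewrite /f expR0 sub0r => h.
have : 0 <= ((1 + c + c ^+ 2 / 2) - expR c) * - x.
  rewrite mulr_ge0 ?oppr_cp0 ?(ltW x0)// subr_ge0; apply: expR_le_taylor2.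
  by move: cx; rewrite in_itv/= => /andP[_ /ltW].
by move: h; lra.
Qed.

Lemma expR_le_quad x : x <= 49 / 100 -> expR x <= 1 + x + 65 / 100 * x ^+ 2.
Proof.
move=> xle; have [x0|x0] := leP x 0.
  by rewrite (le_trans (expR_le_taylor2 x0))//; nra.
have h : 1 + - x + x ^+ 2 / 2 - x ^+ 3 / 6 <= expR (- x).
  have /expR_ge_taylor3 : - x <= 0 by lra.
  by lra.
have q0 : 0 < 1 + x + 65 / 100 * x ^+ 2 by nra.
rewrite -[x in leLHS]opprK expRN -[leLHS]div1r ler_pdivrMr ?expR_gt0; [|by []].
apply: le_trans (ler_wpM2l (ltW q0) h).
(* The quadratic times the cubic lower bound of [exp (- x)] exceeds 1 by [x ^+ 2] times the
   polynomial in the last [have]. On the range considered [95 / 600 - 65 / 600 * x] is at least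
   [105 / 1000], which reduces its sign to that of a quadratic. *)
have k0 : 0 <= 15 / 100 - 95 / 300 * x + x * x * (105 / 1000) by nra.
have k1 : 0 <= x * x * (95 / 600 - 65 / 600 * x - 105 / 1000).
  by apply: mulr_ge0; [apply: mulr_ge0|]; lra.
have : 0 <= x * x * (15 / 100 - 95 / 300 * x + x * x * (95 / 600 - 65 / 600 * x)).
  by apply: mulr_ge0; [apply: mulr_ge0|]; lra.
by rewrite !exprS expr0; lra.
Qed.

(** Low-order Taylor bounds are accurate at [- 1 / 8], and three squarings lead back to [e]. The
    fractions in the next two proofs are roundings that keep the numbers small. *)
Lemma expR1_eighth : expR 1 = (expR (- (8^-1))) ^- 8 :> R.
Proof. by rewrite -expRM_natl -expRN mulrN opprK mulfV. Qed.

(** The value [677 / 250] is nearly the least for which [1.95 / (2 (e - 2)) <= 689 / 500]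
    follows. *)
Lemma expR1_ge : 677 / 250 <= expR 1 :> R.
Proof.
have x0 : 0 <= expR (- (8^-1)) :> R by exact: expR_ge0.
have x1 : expR (- (8^-1)) <= 113 / 128 :> R.
  by apply: le_trans (expR_le_taylor2 _) _; lra.
have x2 : expR (- (8^-1)) ^+ 2 <= 53 / 68 :> R.
  by apply: le_trans (ler_pM x0 x0 x1 x1) _; lra.
have x4 : (expR (- (8^-1)) ^+ 2) ^+ 2 <= 48 / 79 :> R.
  by apply: le_trans (ler_pM (sqr_ge0 _) (sqr_ge0 _) x2 x2) _; lra.
have x8 := ler_pM (sqr_ge0 _) (sqr_ge0 _) x4 x4.
rewrite expR1_eighth (exprM _ 4 2) (exprM _ 2 2) -[leRHS]div1r ler_pdivlMr.
  by rewrite [X in _ * X]expr2; lra.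
by rewrite !exprn_gt0 ?expR_gt0.
Qed.

(** At [68 / 25] one has exactly [2 (e - 2) = 1.2 ^ 2]: this is the constant [1.2] of the tuned
    bound. *)
Lemma expR1_le : expR 1 <= 68 / 25 :> R.
Proof.
have x1 : 2711 / 3072 <= expR (- (8^-1)) :> R.
  by apply: le_trans _ (expR_ge_taylor3 _); lra.
have x2 : 88 / 113 <= expR (- (8^-1)) ^+ 2 :> R.
  by apply: le_trans (ler_pM _ _ x1 x1); lra.
have x4 : 94 / 155 <= (expR (- (8^-1)) ^+ 2) ^+ 2 :> R.
  by apply: le_trans (ler_pM _ _ x2 x2); lra.
have x8 : 25 / 68 <= ((expR (- (8^-1)) ^+ 2) ^+ 2) ^+ 2 :> R.
  by apply: le_trans (ler_pM _ _ x4 x4); lra.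
rewrite expR1_eighth (exprM _ 4 2) (exprM _ 2 2) -[leLHS]div1r ler_pdivrMr.
  by lra.
by rewrite !exprn_gt0 ?expR_gt0.
Qed.

End exponential_bounds.

(** * Geometric resampling *)

Lemma prod_option (R : comNzRingType) (I : finType) (F : option I -> R) :
  \prod_k F k = F None * \prod_k F (Some k).
Proof.
rewrite (bigD1 None)//=; congr (_ * _).
rewrite (reindex_omap Some id)/=; last by case.
by apply: eq_bigl => k; rewrite eqxx.
Qed.

(** * Expectation under a finite product law *)

Section product_expectation.
Context {R : realFieldType} {I A : finType}.
Variable p : A -> R.
Hypothesis p_ge0 : forall x, 0 <= p x.
Hypothesis p_sum1 : \sum_x p x = 1.

Definition prod_mass (a : {ffun I -> A}) : R := \prod_k p (a k).

Definition prod_exp (phi : {ffun I -> A} -> R) : R :=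
  \sum_a prod_mass a * phi a.

Lemma prod_mass_ge0 a : 0 <= prod_mass a.
Proof. exact: prodr_ge0. Qed.

Lemma prod_exp_prod (f : I -> A -> R) :
  prod_exp (fun a => \prod_k f k (a k)) = \prod_k \sum_x p x * f k x.
Proof.
rewrite /prod_exp /prod_mass bigA_distr_bigA; apply: eq_bigr => a _.
by rewrite big_split.
Qed.

Lemma prod_exp_cst c : prod_exp (fun=> c) = c.
Proof.
rewrite /prod_exp -mulr_suml -[RHS]mul1r; congr (_ * _).
have := prod_exp_prod (fun _ _ => 1).
rewrite [RHS]big1 => [<-|k _]; last by under eq_bigr do rewrite mulr1.
by apply: eq_bigr => a _; rewrite [X in _ * X]big1 ?mulr1.
Qed.

Lemma prod_expD f g :
  prod_exp (fun a => f a + g a) = prod_exp f + prod_exp g.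
Proof.
by rewrite /prod_exp -big_split/=; apply: eq_bigr => a _; rewrite mulrDr.
Qed.

Lemma prod_expZ c f : prod_exp (fun a => c * f a) = c * prod_exp f.
Proof.
by rewrite /prod_exp mulr_sumr; apply: eq_bigr => a _; rewrite mulrCA.
Qed.

Lemma prod_exp_sum (J : finType) (P : pred J) (F : J -> {ffun I -> A} -> R) :
  prod_exp (fun a => \sum_(j | P j) F j a) = \sum_(j | P j) prod_exp (F j).
Proof.
rewrite /prod_exp exchange_big/=; apply: eq_bigr => a _.
by rewrite mulr_sumr.
Qed.

Lemma eq_prod_exp f g : f =1 g -> prod_exp f = prod_exp g.
Proof. by move=> fg; apply: eq_bigr => a _; rewrite fg. Qed.

(** Restricted to the support because the bound [m] on the size of an action is available only for
    actions of positive probability. *)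
Lemma ler_prod_exp f g :
  (forall a, prod_mass a != 0 -> f a <= g a) -> prod_exp f <= prod_exp g.
Proof.
move=> fg; apply: ler_sum => a _; have [->|a0] := eqVneq (prod_mass a) 0.
  by rewrite !mul0r.
by rewrite ler_wpM2l ?prod_mass_ge0 ?fg.
Qed.

Lemma prod_mass_neq0 a k : prod_mass a != 0 -> p (a k) != 0.
Proof. by move/prodf_neq0; exact. Qed.

End product_expectation.

Section resampling_count.
Context {M : nat}.
Implicit Type b : 'I_M -> bool.

Lemma resampling_count_le b : (resampling_count b <= M)%N.
Proof.
by rewrite /resampling_count; elim/big_rec: _ => // k n _; exact/leq_trans/geq_minr.
Qed.

(** Sample [k] counts as [k.+1], so exceeding [j] means no hit among the first [j] samples; as
    [j < M], the cap at [M] does not interfere. *)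
Lemma ltn_resampling_count b (j : 'I_M) :
  (j < resampling_count b)%N = [forall k : 'I_M, (k < j)%N ==> ~~ b k].
Proof.
apply/idP/forallP => [jK k|h].
  apply/implyP => kj; apply/negP => bk; move: jK; rewrite ltnNge => /negP; apply.
  rewrite /resampling_count.
  have: k \in index_enum 'I_M by exact: mem_index_enum.
  elim: (index_enum _) => // l s IHs; rewrite inE big_cons => /predU1P[<-|ks].
    by rewrite bk (leq_trans (geq_minl _ _)).
  by case: ifP => _; rewrite ?(leq_trans (geq_minr _ _))// IHs.
rewrite /resampling_count; elim/big_rec: _ => [//|k n bk jn].
rewrite leq_min jn andbT ltnS leqNgt; apply/negP => kj.
by move: (h k); rewrite kj bk.
Qed.

(** Summation by layers: moments of [K] reduce to the events [j < K], which are products over the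
    samples. *)
Lemma sum_diff_ltn (R : pzRingType) (g : nat -> R) K N : (K <= N)%N ->
  \sum_(j < N) (g j.+1 - g j) * (j < K)%N%:R = g K - g 0%N.
Proof.
move=> KN; rewrite -(big_mkord xpredT (fun j => (g j.+1 - g j) * (j < K)%N%:R)).
rewrite (@big_cat_nat _ _ _ K)//= [X in _ + X]big_nat_cond.
rewrite [X in _ + X]big1 ?addr0.
  rewrite (@telescope_sumr_eq _ _ _ g)// => i /andP[_ iK].
  by rewrite iK mulr1.
by move=> i /andP[/andP[Ki _] _]; rewrite ltnNge Ki mulr0.
Qed.

End resampling_count.

Section resampling_expectation.
Context {R : realFieldType} {d M : nat}.
Variable p : action d -> R.
Hypothesis p_ge0 : forall x, 0 <= p x.
Hypothesis p_sum1 : \sum_x p x = 1.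

Local Notation samples := {ffun option 'I_M -> action d}.
Local Notation E := (prod_exp p).

(* [inclusion i] is q_(t,i) and [waiting a i] is K_(t,i), when [a None] is the
   action played and [a (Some k)] are the resampled ones. *)
Definition inclusion (i : 'I_d) : R := \sum_v p v * (v i)%:R.

Definition waiting (a : option 'I_M -> action d) (i : 'I_d) : nat :=
  resampling_count (fun k => a (Some k) i).

Local Notation q := inclusion.

Lemma inclusion_ge0 i : 0 <= q i.
Proof. by apply: sumr_ge0 => v _; rewrite mulr_ge0. Qed.

Lemma inclusion_compl i : \sum_v p v * (1 - (v i)%:R) = 1 - q i.
Proof.
by under eq_bigr do rewrite mulrBr mulr1; rewrite sumrB p_sum1.
Qed.

Lemma inclusion_le1 i : q i <= 1.
Proof.
rewrite -subr_ge0 -inclusion_compl; apply: sumr_ge0 => v _.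
by rewrite mulr_ge0// subr_ge0; case: (v i).
Qed.

(** The event asks the played action to contain [i] and each of the first [j] resampled ones to omit
    it, so its indicator is a product over independent samples. *)
Lemma exp_included_waiting i (j : 'I_M) :
  E (fun a : samples => (a None i)%:R * (j < waiting a i)%N%:R)
  = q i * (1 - q i) ^+ j.
Proof.
pose f (k : option 'I_M) (v : action d) : R :=
  if k is Some k then if (k < j)%N then 1 - (v i)%:R else 1 else (v i)%:R.
transitivity (E (fun a : samples => \prod_k f k (a k))).
  apply: eq_prod_exp => a; rewrite prod_option/=; congr (_ * _).
  rewrite /waiting ltn_resampling_count.
  have [/forallP h|] := boolP [forall k : 'I_M, (k < j)%N ==> ~~ a (Some k) i].
    rewrite big1// => k _; move/implyP: (h k); case: ifP => // _ /(_ isT).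
    by move/negbTE => ->; rewrite subr0.
  rewrite negb_forall => /existsP[k]; rewrite negb_imply negbK => /andP[kj ak].
  by rewrite (bigD1 k)//= kj ak subrr mul0r.
rewrite prod_exp_prod prod_option/=; congr (_ * _).
transitivity (\prod_(k < M) (if (k < j)%N then 1 - q i else 1)).
  apply: eq_bigr => k _; case: ifP => _; first exact: inclusion_compl.
  by under eq_bigr do rewrite mulr1.
by rewrite -big_mkcond/= (big_ord_narrow (ltnW (ltn_ord j))) prodr_const card_ord.
Qed.

Lemma exp_included_fun i (g : nat -> R) : g 0%N = 0 ->
  E (fun a : samples => (a None i)%:R * g (waiting a i))
  = \sum_(j < M) (g j.+1 - g j) * (q i * (1 - q i) ^+ j).
Proof.
move=> g0; transitivity (E (fun a : samples => \sum_(j < M)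
    (g j.+1 - g j) * ((a None i)%:R * (j < waiting a i)%N%:R))).
  apply: eq_prod_exp => a; have := sum_diff_ltn g (resampling_count_le (fun k => a (Some k) i)).
  rewrite g0 subr0 => /= <-; rewrite mulr_sumr.
  by apply: eq_bigr => j _; rewrite mulrCA.
by rewrite prod_exp_sum; apply: eq_bigr => j _; rewrite prod_expZ exp_included_waiting.
Qed.

Lemma exp_waiting i :
  E (fun a : samples => (a None i)%:R * (waiting a i)%:R) = 1 - (1 - q i) ^+ M.
Proof.
rewrite (exp_included_fun i (g := fun n => n%:R))//.
rewrite -[X in _ = X - _](expr1n _ M) subrXX opprB addrCA subrr addr0.
rewrite mulr_sumr; apply: eq_bigr => j _.
by rewrite expr1n !mul1r -natrB// subSnn mul1r.
Qed.

Lemma sum_odd_geometric (r : R) n :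
  \sum_(j < n) (j.+1%:R ^+ 2 - j%:R ^+ 2) * r ^+ j * (1 - r) ^+ 2
  = 1 + r - r ^+ n * ((2 * n%:R + 1) - (2 * n%:R - 1) * r).
Proof.
elim: n => [|n IHn]; first by rewrite big_ord0 expr0; ring.
rewrite big_ord_recr/= IHn [r ^+ n.+1]exprS -[n.+1%:R]natr1; ring.
Qed.

(** With [r = 1 - q i], the sum of [(2 j + 1) r ^ j (1 - r) ^ 2] is at most [1 + r]. The factor
    [q i] stays on the left since it may vanish; it is also the weight with which the second moment
    occurs later. *)
Lemma exp_waiting_sq i :
  q i * E (fun a : samples => (a None i)%:R * (waiting a i)%:R ^+ 2) <= 2.
Proof.
rewrite (exp_included_fun i (g := fun n => n%:R ^+ 2)) ?expr0n//.
have q0 := inclusion_ge0 i; have q1 := inclusion_le1 i.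
have -> : q i * (\sum_(j < M) (j.+1%:R ^+ 2 - j%:R ^+ 2) * (q i * (1 - q i) ^+ j))
    = \sum_(j < M) (j.+1%:R ^+ 2 - j%:R ^+ 2) * (1 - q i) ^+ j * (1 - (1 - q i)) ^+ 2.
  by rewrite mulr_sumr; apply: eq_bigr => j _; rewrite opprB addrCA subrr addr0; ring.
rewrite sum_odd_geometric.
have : 0 <= (1 - q i) ^+ M * (2 * M%:R + 1 - (2 * M%:R - 1) * (1 - q i)).
  apply: mulr_ge0; first by rewrite exprn_ge0// subr_ge0.
  have : 0 <= 2 * M%:R * q i by rewrite !mulr_ge0.
  by lra.
by lra.
Qed.

End resampling_expectation.

(** * One round *)

Section log_estimate.
Context {R : realType}.
Variable beta : R.
Hypothesis beta_gt0 : 0 < beta.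

(** Substituting [y = exp s - 1] turns the difference of the two sides, up to a constant, into a
    function of [s] with derivative [(exp s - 1) ^ 2]. *)
Lemma ln1D_ge (y : R) : 0 <= y -> y - y ^+ 2 / 2 <= ln (1 + y).
Proof.
rewrite le_eqVlt => /predU1P[<-|y0]; first by rewrite addr0 ln1; lra.
pose t := ln (1 + y); have t0 : 0 < t by rewrite ln_gt0// ltrDl.
pose f (s : R) := s - 2 * expR s + expR s * expR s / 2.
have df (s : R) : is_derive s 1 f ((expR s - 1) ^+ 2).
  by apply: is_derive_eq; rewrite /GRing.scale/=; field.
have [|c _] := @MVT R f _ 0 t t0 (fun y _ => df y).
  by apply: derivable_within_continuous => s _; exact: ex_derive.
rewrite /f expR0 /t lnK ?posrE; last by rewrite addr_gt0.
rewrite -/t => h; have := mulr_ge0 (sqr_ge0 (expR c - 1)) (ltW t0).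
by move: h; rewrite subr0 => <-; lra.
Qed.

Definition log_est (x : R) : R := beta^-1 * ln (1 + beta * x).

Lemma log_est_ge0 x : 0 <= x -> 0 <= log_est x.
Proof.
move=> x0; rewrite mulr_ge0 ?invr_ge0 ?(ltW beta_gt0)// ln_ge0//.
by rewrite lerDl mulr_ge0 ?(ltW beta_gt0).
Qed.

Lemma log_est_le x : 0 <= x -> log_est x <= x.
Proof.
move=> x0; rewrite /log_est ler_pdivrMl// le_ln1Dx//.
by rewrite (lt_le_trans _ (mulr_ge0 (ltW beta_gt0) x0))// ltrN10.
Qed.

Lemma log_est_ge x : 0 <= x -> x - beta / 2 * x ^+ 2 <= log_est x.
Proof.
move=> x0; rewrite /log_est ler_pdivlMl//.
apply: le_trans (ln1D_ge (mulr_ge0 (ltW beta_gt0) x0)).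
by rewrite le_eqVlt; apply/orP; left; apply/eqP; field.
Qed.

Lemma expR_log_est x : 0 <= x -> expR (beta * log_est x) = 1 + beta * x.
Proof.
move=> x0; rewrite /log_est mulrA mulfV ?gt_eqF// mul1r lnK// posrE.
by rewrite ltr_pwDl// mulr_ge0 ?(ltW beta_gt0).
Qed.

End log_estimate.

(** * Inner products with actions of bounded size *)

Section dotp.
Context {R : realType} {d : nat}.
Implicit Types (u v : action d) (x y : 'I_d -> R).

Lemma dotp_ge0 v x : (forall i, 0 <= x i) -> 0 <= dotp v x.
Proof. by move=> x0; apply: sumr_ge0 => i _; rewrite mulr_ge0. Qed.

Lemma ler_dotp v x y : (forall i, x i <= y i) -> dotp v x <= dotp v y.
Proof. by move=> xy; apply: ler_sum => i _; rewrite ler_wpM2l. Qed.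

Lemma dotpD v x y : dotp v (fun i => x i + y i) = dotp v x + dotp v y.
Proof. by rewrite /dotp -big_split/=; apply: eq_bigr => i _; rewrite mulrDr. Qed.

Lemma dotpZ v c x : dotp v (fun i => c * x i) = c * dotp v x.
Proof. by rewrite /dotp mulr_sumr; apply: eq_bigr => i _; rewrite mulrCA. Qed.

Lemma dotp_le_cst m v x c : (\sum_(i < d) v i <= m)%N -> 0 <= c ->
  (forall i, x i <= c) -> dotp v x <= m%:R * c.
Proof.
move=> vm c0 xc; apply: (@le_trans _ _ (\sum_(i < d) (v i)%:R * c)).
  by apply: ler_sum => i _; rewrite ler_wpM2l.
by rewrite -mulr_suml -natr_sum ler_wpM2r// ler_nat.
Qed.

(** Cauchy-Schwarz for the 0-1 weights of [v], by [2 x_i x_j <= x_i ^ 2 + x_j ^ 2] in the double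
    sum. *)
Lemma sqr_dotp_le m v x : (\sum_(i < d) v i <= m)%N ->
  dotp v x ^+ 2 <= m%:R * dotp v (fun i => x i ^+ 2).
Proof.
move=> vm; set N := \sum_(i < d) (v i)%:R : R.
have -> : dotp v x ^+ 2 =
    \sum_(i < d) \sum_(j < d) (v i)%:R * (v j)%:R * (x i * x j).
  rewrite expr2 /dotp mulr_suml; apply: eq_bigr => i _.
  by rewrite mulr_sumr; apply: eq_bigr => j _; ring.
apply: (@le_trans _ _ (\sum_(i < d) \sum_(j < d)
    (v i)%:R * (v j)%:R * ((x i ^+ 2 + x j ^+ 2) / 2))).
  apply: ler_sum => i _; apply: ler_sum => j _; rewrite ler_wpM2l ?mulr_ge0//.
  by have := sqr_ge0 (x i - x j); lra.
have -> : \sum_(i < d) \sum_(j < d)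
    (v i)%:R * (v j)%:R * ((x i ^+ 2 + x j ^+ 2) / 2) = N * dotp v (fun i => x i ^+ 2).
  transitivity (\sum_(i < d) ((v i)%:R * x i ^+ 2 / 2 * N
      + (v i)%:R / 2 * dotp v (fun i => x i ^+ 2))).
    apply: eq_bigr => i _; rewrite /N /dotp 2!mulr_sumr -big_split/=.
    by apply: eq_bigr => j _; field.
  by rewrite big_split/= -!mulr_suml -/N -/(dotp v (fun i => x i ^+ 2)); field.
apply: ler_wpM2r; first by apply: dotp_ge0 => i; exact: sqr_ge0.
by rewrite /N -natr_sum ler_nat.
Qed.

End dotp.

(** * Moments of one round for a fixed past *)

Section one_round.
Context {R : realType} {d M m : nat}.
Variables (p : action d -> R) (eta beta : R) (ell : 'I_d -> R).
Hypothesis p_ge0 : forall x, 0 <= p x.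
Hypothesis p_sum1 : \sum_x p x = 1.
Hypothesis p_size : forall v, p v != 0 -> (\sum_(i < d) v i <= m)%N.
Hypothesis eta_gt0 : 0 < eta.
Hypothesis beta_gt0 : 0 < beta.
Hypothesis ell01 : forall i, 0 <= ell i <= 1.
Hypothesis M_gt0 : (0 < M)%N.

Local Notation samples := {ffun option 'I_M -> action d}.
Local Notation E := (prod_exp p).
Local Notation q := (inclusion p).

(* [iw_est] is l^_t and [round_est] is l~_t. *)
Definition iw_est (a : option 'I_M -> action d) i : R :=
  (waiting a i)%:R * (a None i)%:R * ell i.

Definition round_est (a : option 'I_M -> action d) i : R :=
  log_est beta (iw_est a i).

(** This is [B_t]; the exponential factor is the price of passing from [p_t] to [p_(t+1)]. *)
Definition discounted_loss (x : 'I_d -> R) : R :=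
  \sum_u p u * (expR (- (eta * dotp u x)) * dotp u x).

Definition round_excess (a : option 'I_M -> action d) : R :=
  dotp (a None) ell - discounted_loss (round_est a).

Definition drift : R :=
  d%:R / (expR 1 * M%:R) + beta * d%:R + eta * (2 * m%:R * d%:R).

Lemma ell_ge0 i : 0 <= ell i. Proof. by have /andP[] := ell01 i. Qed.
Lemma ell_le1 i : ell i <= 1. Proof. by have /andP[] := ell01 i. Qed.

Lemma iw_est_ge0 a i : 0 <= iw_est a i.
Proof. by rewrite !mulr_ge0// ell_ge0. Qed.

Lemma exp_iw_est i :
  E (fun a : samples => iw_est a i) = ell i * (1 - (1 - q i) ^+ M).
Proof.
rewrite -(@exp_waiting _ _ M _ p_sum1) -prod_expZ; apply: eq_prod_exp => a.
by rewrite /iw_est; ring.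
Qed.

Lemma exp_log_est_le1 i :
  E (fun a : samples => expR (beta * (round_est a i - ell i))) <= 1.
Proof.
rewrite (@eq_prod_exp _ _ _ _ _
  (fun a : samples => expR (- (beta * ell i)) * (1 + beta * iw_est a i))); last first.
  by move=> a; rewrite mulrBr addrC expRD expR_log_est// iw_est_ge0.
rewrite prod_expZ prod_expD prod_exp_cst// prod_expZ exp_iw_est.
rewrite expRN mulrC ler_pdivrMr ?expR_gt0// mul1r.
apply: le_trans (expR_ge1Dx _); rewrite lerD2l ler_wpM2l ?(ltW beta_gt0)//.
rewrite ler_piMr ?ell_ge0// gerBl exprn_ge0// subr_ge0.
exact: inclusion_le1.
Qed.

(** The second-order error of [B_t]. The weight [q i] compensates the growth of the squared
    estimate, whose mean is of order [1 / q i]. *)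
Definition sq_iw_est (a : option 'I_M -> action d) : R :=
  \sum_i q i * iw_est a i ^+ 2.

Lemma sum_p_dotp x : \sum_u p u * dotp u x = \sum_i q i * x i.
Proof.
rewrite /dotp /inclusion.
under eq_bigr do rewrite mulr_sumr.
rewrite exchange_big/=; apply: eq_bigr => i _; rewrite mulr_suml.
by apply: eq_bigr => u _; rewrite mulrA.
Qed.

Lemma iw_est_sqr_le a i :
  iw_est a i ^+ 2 <= (a None i)%:R * (waiting a i)%:R ^+ 2.
Proof.
rewrite /iw_est; have l0 := ell_ge0 i; have l1 := ell_le1 i.
case: (a None i); last by rewrite mulr0 !mul0r expr0n.
rewrite mulr1 mul1r exprMn ler_piMr ?sqr_ge0//.
by rewrite expr_le1.
Qed.

Lemma exp_sq_iw_est_le : E (fun a : samples => sq_iw_est a) <= 2 * d%:R.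
Proof.
rewrite /sq_iw_est prod_exp_sum.
apply: (@le_trans _ _ (\sum_(i < d) 2)); last by rewrite sumr_const card_ord mulr_natr.
apply: ler_sum => i _; rewrite prod_expZ.
apply: le_trans (@exp_waiting_sq _ _ M _ p_ge0 p_sum1 i).
rewrite ler_wpM2l ?inclusion_ge0//; apply: ler_prod_exp => // a _.
exact: iw_est_sqr_le.
Qed.

Lemma round_est_ge0 a i : 0 <= round_est a i.
Proof. by rewrite log_est_ge0// iw_est_ge0. Qed.

Lemma discounted_loss_ge0 x : (forall i, 0 <= x i) -> 0 <= discounted_loss x.
Proof.
move=> x0; apply: sumr_ge0 => u _.
by rewrite !mulr_ge0 ?expR_ge0// dotp_ge0.
Qed.

Lemma discounted_loss_le a :
  discounted_loss (round_est a) <= \sum_i q i * iw_est a i.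
Proof.
rewrite -sum_p_dotp; apply: ler_sum => u _; rewrite ler_wpM2l//.
have d0 : 0 <= dotp u (round_est a) by apply: dotp_ge0 => i; exact: round_est_ge0.
apply: (@le_trans _ _ (dotp u (round_est a))).
  by rewrite ler_piMl// expR_le1 oppr_le0 mulr_ge0// ltW.
by apply: ler_dotp => i; rewrite log_est_le// iw_est_ge0.
Qed.

(** There are two second-order errors: [beta / 2] times the squared estimate from the logarithm, and
    [eta * m] times it from [exp (- y) >= 1 - y] followed by Cauchy-Schwarz on the at most [m]
    coordinates of [u]. *)
Lemma discounted_loss_ge a :
  \sum_i q i * iw_est a i - (beta / 2 + eta * m%:R) * sq_iw_est a
    <= discounted_loss (round_est a).
Proof.
have -> : \sum_i q i * iw_est a i - (beta / 2 + eta * m%:R) * sq_iw_est a =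
  \sum_u p u * (dotp u (fun i => iw_est a i - beta / 2 * iw_est a i ^+ 2)
    - eta * (m%:R * dotp u (fun i => iw_est a i ^+ 2))).
  transitivity (\sum_u (p u * dotp u (fun i => iw_est a i - beta / 2 * iw_est a i ^+ 2)
      - eta * m%:R * (p u * dotp u (fun i => iw_est a i ^+ 2)))); last first.
    by apply: eq_bigr => u _; ring.
  rewrite sumrB -mulr_sumr !sum_p_dotp /sq_iw_est mulrDl opprD addrA.
  by congr (_ - _); rewrite mulr_sumr -sumrB; apply: eq_bigr => i _; ring.
apply: ler_sum => u _; have [->|pu0] := eqVneq (p u) 0; first by rewrite !mul0r.
rewrite ler_wpM2l//; set x := dotp u (round_est a).
have x0 : 0 <= x by apply: dotp_ge0 => i; exact: round_est_ge0.
have h1 : dotp u (fun i => iw_est a i - beta / 2 * iw_est a i ^+ 2) <= x.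
  by apply: ler_dotp => i; rewrite log_est_ge// iw_est_ge0.
have h2 : x ^+ 2 <= m%:R * dotp u (fun i => iw_est a i ^+ 2).
  apply: le_trans (sqr_dotp_le _ (p_size pu0)).
  rewrite lerXn2r ?nnegrE//; first by apply: dotp_ge0 => i; exact: iw_est_ge0.
  by apply: ler_dotp => i; rewrite log_est_le// iw_est_ge0.
have h3 : eta * x ^+ 2 <= eta * (m%:R * dotp u (fun i => iw_est a i ^+ 2)).
  by rewrite ler_wpM2l// ltW.
have h4 : (1 - eta * x) * x <= expR (- (eta * x)) * x.
  by rewrite ler_wpM2r// expR_ge1Dx.
by lra.
Qed.

(** With [y = M q]: [(1 - q) ^ M <= exp (- y)] and [y <= exp (y - 1)]. *)
Lemma inclusion_bias_le i : q i * (1 - q i) ^+ M <= (expR 1 * M%:R)^-1.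
Proof.
have q0 := inclusion_ge0 p_ge0 i; have q1 := inclusion_le1 p_ge0 p_sum1 i.
rewrite -[leRHS]div1r ler_pdivlMr ?mulr_gt0 ?expR_gt0 ?ltr0n//.
have pow_le : (1 - q i) ^+ M <= expR (- (M%:R * q i)).
  rewrite -mulrN expRM_natl lerXn2r ?nnegrE ?subr_ge0 ?expR_ge0//.
  exact: expR_ge1Dx.
have := ler_wpM2l (mulr_ge0 (mulr_ge0 (ler0n R M) q0) (expR_ge0 1)) pow_le.
set y := M%:R * q i => le1; have le2 : y * expR 1 * expR (- y) <= 1.
  rewrite -mulrA -expRD -[X in _ * expR X]opprK -ler_pdivlMr; last first.
    by rewrite expR_gt0.
  rewrite div1r -expRN opprK opprB; apply: le_trans (expR_ge1Dx _); lra.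
by apply: le_trans le2; apply: le_trans le1; rewrite /y le_eqVlt; apply/orP; left; apply/eqP; ring.
Qed.

(** The first-order parts differ only through the cap on resampling, by
    [q i * (1 - q i) ^+ M * ell i] per coordinate. The second-order part has mean at most
    [(beta / 2 + eta m) * 2 d]. *)
Lemma exp_round_excess_le : E (fun a : samples => round_excess a) <= drift.
Proof.
apply: (@le_trans _ _ (E (fun a : samples => (dotp (a None) ell
    + - 1 * (\sum_i q i * iw_est a i)) + (beta / 2 + eta * m%:R) * sq_iw_est a))).
  by apply: ler_prod_exp => // a _; rewrite /round_excess; have := discounted_loss_ge a; lra.
rewrite !prod_expD !prod_expZ.
have -> : E (fun a : samples => dotp (a None) ell) = \sum_i q i * ell i.
  pose f (k : option 'I_M) (v : action d) : R := if k is None then dotp v ell else 1.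
  rewrite -sum_p_dotp; transitivity (E (fun a : samples => \prod_k f k (a k))).
    by apply: eq_prod_exp => a; rewrite prod_option/= big1 ?mulr1.
  rewrite prod_exp_prod prod_option/= [X in _ * X]big1 ?mulr1// => k _.
  by under eq_bigr do rewrite mulr1.
rewrite prod_exp_sum.
under [X in -1 * X]eq_bigr do rewrite prod_expZ exp_iw_est.
have h1 : (beta / 2 + eta * m%:R) * E (fun a : samples => sq_iw_est a) <=
    (beta / 2 + eta * m%:R) * (2 * d%:R).
  by rewrite ler_wpM2l ?exp_sq_iw_est_le// addr_ge0 ?mulr_ge0 ?invr_ge0// ltW.
have h2 : \sum_i q i * ell i + -1 * (\sum_i q i * (ell i * (1 - (1 - q i) ^+ M)))
    <= d%:R / (expR 1 * M%:R).
  rewrite mulN1r -sumrB.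
  apply: (@le_trans _ _ (\sum_(i < d) (expR 1 * M%:R)^-1)).
    apply: ler_sum => i _; apply: le_trans (inclusion_bias_le i).
    have -> : q i * ell i - q i * (ell i * (1 - (1 - q i) ^+ M)) =
      q i * (1 - q i) ^+ M * ell i by ring.
    rewrite ler_piMr ?ell_le1// mulr_ge0 ?inclusion_ge0// exprn_ge0// subr_ge0.
    exact: inclusion_le1.
  by rewrite sumr_const card_ord -[leLHS]mulr_natl.
by rewrite /drift; move: h1 h2; lra.
Qed.

Lemma sum_inclusion_le : \sum_i q i <= m%:R.
Proof.
have -> : \sum_i q i = \sum_u p u * dotp u (fun=> 1).
  by rewrite sum_p_dotp; apply: eq_bigr => i _; rewrite mulr1.
apply: (@le_trans _ _ (\sum_u p u * m%:R)); last by rewrite -mulr_suml p_sum1 mul1r.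
apply: ler_sum => u _; have [->|pu0] := eqVneq (p u) 0; first by rewrite !mul0r.
by rewrite ler_wpM2l// -[leRHS]mulr1 dotp_le_cst// p_size.
Qed.

(** A difference of nonnegative numbers has square at most the sum of the squares; the first gives
    [m ^ 2]. For the second, [B_t] is at most the inner product of the played action with [q K], so
    Cauchy-Schwarz costs [m] and not [d]; one factor [q i] absorbs the second moment of [K], the
    other sums to at most [m]. *)
Lemma exp_round_excess_sq_le :
  E (fun a : samples => round_excess a ^+ 2) <= 3 * m%:R ^+ 2.
Proof.
apply: (@le_trans _ _ (E (fun a : samples => m%:R ^+ 2
   + m%:R * \sum_i q i * (q i * ((a None i)%:R * (waiting a i)%:R ^+ 2))))).
  apply: ler_prod_exp => // a pa0.
  have am : (\sum_(i < d) a None i <= m)%N by apply/p_size/(prod_mass_neq0 _ pa0).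
  set b := discounted_loss (round_est a).
  have b0 : 0 <= b by apply: discounted_loss_ge0 => i; exact: round_est_ge0.
  have a0 : 0 <= dotp (a None) ell by apply: dotp_ge0; exact: ell_ge0.
  have a1 : dotp (a None) ell <= m%:R.
    by rewrite -[leRHS]mulr1 dotp_le_cst//; exact: ell_le1.
  have b2 : b ^+ 2 <= m%:R * \sum_i q i * (q i * ((a None i)%:R * (waiting a i)%:R ^+ 2)).
    have -> : \sum_i q i * (q i * ((a None i)%:R * (waiting a i)%:R ^+ 2)) =
        dotp (a None) (fun i => (q i * (waiting a i)%:R) ^+ 2).
      by apply: eq_bigr => i _; ring.
    apply: le_trans (sqr_dotp_le _ am); rewrite lerXn2r ?nnegrE//.
      by apply: dotp_ge0 => i; rewrite mulr_ge0 ?inclusion_ge0.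
    apply: (le_trans (discounted_loss_le a)); apply: ler_sum => i _.
    have -> : q i * iw_est a i = (a None i)%:R * (q i * (waiting a i)%:R) * ell i.
      by rewrite /iw_est; ring.
    by rewrite ler_piMr ?ell_le1// !mulr_ge0 ?inclusion_ge0.
  have a2 : dotp (a None) ell ^+ 2 <= m%:R ^+ 2 by rewrite lerXn2r ?nnegrE.
  rewrite /round_excess -/b.
  by have := mulr_ge0 a0 b0; lra.
rewrite prod_expD prod_exp_cst// prod_expZ prod_exp_sum.
have : \sum_i E (fun a : samples => q i * (q i * ((a None i)%:R * (waiting a i)%:R ^+ 2)))
   <= 2 * m%:R.
  apply: (@le_trans _ _ (\sum_i q i * 2)); last first.
    by rewrite -mulr_suml mulrC ler_wpM2l// sum_inclusion_le.
  apply: ler_sum => i _; rewrite 2!prod_expZ ler_wpM2l ?inclusion_ge0//.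
  exact: exp_waiting_sq.
move/(ler_wpM2l (ler0n R m)); lra.
Qed.

(** [expR_le_quad] is one-sided, so the upper bound [m] on the excess suffices. *)
Lemma exp_expR_round_excess_le (lam : R) :
    0 <= lam -> lam * m%:R <= 49 / 100 ->
  E (fun a : samples => expR (lam * round_excess a))
    <= expR (lam * drift + 195 / 100 * (lam * m%:R) ^+ 2).
Proof.
move=> lam0 lamm.
apply: (@le_trans _ _ (E (fun a : samples => 1 + (lam * round_excess a
   + 65 / 100 * lam ^+ 2 * round_excess a ^+ 2)))).
  apply: ler_prod_exp => // a pa0.
  have am : (\sum_(i < d) a None i <= m)%N by apply/p_size/(prod_mass_neq0 _ pa0).
  have b0 : 0 <= discounted_loss (round_est a).
    by apply: discounted_loss_ge0 => i; exact: round_est_ge0.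
  have a1 : dotp (a None) ell <= m%:R.
    by rewrite -[leRHS]mulr1 dotp_le_cst//; exact: ell_le1.
  have le : lam * round_excess a <= 49 / 100.
    by apply: le_trans lamm; rewrite ler_wpM2l// /round_excess; lra.
  by apply: le_trans (expR_le_quad le) _; rewrite exprMn; lra.
rewrite !prod_expD prod_exp_cst// !prod_expZ.
apply: le_trans (expR_ge1Dx _); rewrite lerD2l lerD//.
  by rewrite ler_wpM2l// exp_round_excess_le.
have := ler_wpM2l (sqr_ge0 lam) exp_round_excess_sq_le.
by rewrite exprMn; lra.
Qed.

End one_round.

(** * Measurability of finite-valued functions and of the argmin *)

Section finite_valued.
Context {dO} {Omega : measurableType dO} {R : realType}.

Lemma measurable_setb (b : Omega -> bool) :
  measurable_fun setT b -> measurable [set w | b w].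
Proof. by move=> mb; rewrite -[X in measurable X]setTI; exact: (mb _ [set true]). Qed.

Lemma measurable_forall_fin (I : finType) (F : I -> set Omega) :
  (forall i, measurable (F i)) -> measurable [set w | forall i, F i w].
Proof.
move=> mF; rewrite [X in measurable X](_ : _ = \bigcap_(i in [set: I]) F i).
  by apply: fin_bigcap_measurable => //; exact: finite_finset.
by apply/seteqP; split => [w h i _|w h i]; [exact: h|exact: (h i)].
Qed.

Lemma measurable_exists_fin (I : finType) (F : I -> set Omega) :
  (forall i, measurable (F i)) -> measurable [set w | exists i, F i w].
Proof.
move=> mF; rewrite [X in measurable X](_ : _ = \bigcup_(i in [set: I]) F i).
  by apply: fin_bigcup_measurable => //; exact: finite_finset.
by apply/seteqP; split => [w [i h]|w [i _ h]]; exists i.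
Qed.

(** The argmin has this form: its bits are the comparisons between pairs of actions. *)
Lemma measurable_fin_fun (I A : finType) (b : Omega -> I -> bool)
    (g : {ffun I -> bool} -> A) (a : A) :
  (forall i, measurable [set w | b w i]) ->
  measurable [set w | g [ffun i => b w i] = a].
Proof.
move=> mb; rewrite [X in measurable X](_ : _ =
  [set w | exists c : {ffun I -> bool}, (g c = a) /\ (forall i, b w i = c i)]).
  apply: measurable_exists_fin => c; have [gc|gc] := pselect (g c = a).
    rewrite [X in measurable X](_ : _ = [set w | forall i, b w i = c i]).
      apply: measurable_forall_fin => i; case: (c i); first exact: mb.
      rewrite [X in measurable X](_ : _ = ~` [set w | b w i]).
        exact: measurableC.
      by apply/seteqP; split => [w /= ->|w /= /negP/negbTE].
    by apply/seteqP; split => [w []|w].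
  by rewrite [X in measurable X](_ : _ = set0)//; apply/seteqP; split => // w [].
apply/seteqP; split => [w /= <-|w /= [c [<- h]]].
  by exists [ffun i => b w i]; split => // i; rewrite ffunE.
by congr g; apply/ffunP => i; rewrite ffunE h.
Qed.

Lemma measurable_fin_comp d' (T : measurableType d') (A : finType)
    (g : Omega -> A) (phi : A -> T) :
  (forall a, measurable [set w | g w = a]) ->
  measurable_fun setT (fun w => phi (g w)).
Proof.
move=> mg _ B mB; rewrite setTI.
rewrite [X in measurable X](_ : _ = [set w | exists a, B (phi a) /\ g w = a]).
  apply: measurable_exists_fin => a; have [Ba|Ba] := pselect (B (phi a)).
    rewrite [X in measurable X](_ : _ = [set w | g w = a])//.
    by apply/seteqP; split => [w []|w].
  by rewrite [X in measurable X](_ : _ = set0)//; apply/seteqP; split => // w [].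
apply/seteqP; split => [w Bw|w [a [Ba ga]]]; first by exists (g w).
by rewrite /preimage/= ga.
Qed.

Variable P : probability Omega R.

Lemma integral_fin_valued (A : finType) (g : Omega -> A) (phi : A -> R) :
    (forall a, measurable [set w | g w = a]) -> (forall a, 0 <= phi a) ->
  (\int[P]_w (phi (g w))%:E = (\sum_a phi a * fine (P [set w | g w = a]))%:E)%E.
Proof.
move=> mg phi0.
transitivity (\int[P]_w (\sum_a (phi a)%:E * (\1_[set w | g w = a] w)%:E))%E.
  apply: eq_integral => w _; rewrite (bigD1 (g w))//= indicE mem_set//.
  rewrite mule1 big1 ?adde0// => a /eqP ag.
  by rewrite indicE memNset ?mule0//= => /esym.
rewrite ge0_integral_sum//; first last.
- by move=> a w _; rewrite mule_ge0// lee_fin.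
- by move=> a; apply: measurable_funeM; apply/measurable_EFinP; exact: measurable_indic.
rewrite -sumEFin; apply: eq_bigr => a _.
rewrite ge0_integralZl//; first last.
- by rewrite lee_fin.
- by apply/measurable_EFinP; exact: measurable_indic.
rewrite integral_indic// setIT EFinM fineK//.
by rewrite fin_num_measure.
Qed.

Lemma sum_fin_valued (A : finType) (g : Omega -> A) :
  (forall a, measurable [set w | g w = a]) ->
  \sum_a fine (P [set w | g w = a]) = 1.
Proof.
move=> mg; apply: EFin_inj.
have := integral_fin_valued (phi := fun=> 1) mg (fun=> ler01).
rewrite integral_cst// mul1e [X in X = _ -> _](probability_setT P) => ->.
by congr (_%:E); apply: eq_bigr => a _; rewrite mul1r.
Qed.

(** Uniqueness of finite measures on a pi-system containing the whole space; laws, shifts and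
    independence are all transferred through it. *)
Lemma measure_eq_g_sigma (G : set (set Omega)) (m1 m2 : {measure set Omega -> \bar R}) :
    G `<=` measurable -> setI_closed G -> G setT -> (m1 setT < +oo)%E ->
    (forall A, G A -> m1 A = m2 A) ->
  forall A, <<s G >> A -> m1 A = m2 A.
Proof.
move=> Gm GI GT fin eqG A sA.
apply: (g_sigma_algebra_measure_unique G Gm (fun=> setT)) => //.
by rewrite bigcup_const//; exists 0%N.
Qed.

End finite_valued.

(** * The argmin and its ties *)

Section argmin.
Context {R : realType} {d : nat}.
Variable S : {set action d}.
Implicit Types (u v : action d) (x : 'I_d -> R).

Lemma argmin_pick x : argmin_action S x =
  odflt (some_action S)
    [pick v in S | [forall (w | w \in S), dotp v x <= dotp w x]].
Proof. by []. Qed.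

Hypothesis S0 : S != finset.set0.

Lemma some_action_in : some_action S \in S.
Proof.
rewrite /some_action; case: pickP => //= h.
by move/set0Pn: S0 => [v vS]; rewrite h in vS.
Qed.

Lemma argminP x : argmin_action S x \in S /\
  forall v, v \in S -> dotp (argmin_action S x) x <= dotp v x.
Proof.
rewrite /argmin_action; case: arg_minP => [|v vS h]; first exact: some_action_in.
by split.
Qed.

(* [pick] returns the first element in enumeration order, so shrinking the set
   of minimizers to one still containing the chosen action keeps the choice. *)
Lemma pick_sub (A : finType) (P Q : pred A) (a : A) :
  pick P = Some a -> Q a -> (forall b, Q b -> P b) -> pick Q = Some a.
Proof.
rewrite /pick /enum_mem; elim: (Finite.enum A) => //= b s IHs.
move=> + Qa QP; rewrite -!topredE/=; case: ifP => [Pb [ba]|Pb h].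
  by rewrite ba Qa.
by case: ifP => [/QP|_]; [rewrite Pb|exact: IHs].
Qed.

(** Every minimizer for [y] is one for [x], and [u] remains one: the set of minimizers shrinks
    around [u], so the tie-breaking keeps it. *)
Lemma argmin_raise x y u : argmin_action S x = u ->
  dotp u y = dotp u x -> (forall v, dotp v x <= dotp v y) ->
  argmin_action S y = u.
Proof.
move=> xu uy xy; have [uS umin] := argminP x; rewrite xu in uS umin.
have pick_x : [pick v in S | [forall (w | w \in S), dotp v x <= dotp w x]] = Some u.
  rewrite -xu argmin_pick; case: pickP => //= /(_ u).
  by rewrite uS/= => /negP[]; apply/forallP => v; apply/implyP; exact: umin.
rewrite argmin_pick.
rewrite (pick_sub (Q := [pred v in S | [forall (w | w \in S), dotp v y <= dotp w y]]) pick_x)//.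
- rewrite /= uS/=; apply/forallP => w; apply/implyP => wS.
  by rewrite uy (le_trans (umin _ wS)).
- move=> v /andP[vS /forallP h]/=; rewrite vS/=.
  apply/forallP => w; apply/implyP => wS; apply: le_trans (xy v) _.
  have /implyP/(_ uS) := h u; rewrite uy => /le_trans; apply; exact: umin.
Qed.

Lemma measurable_argmin {dO} {Omega : measurableType dO} (x : Omega -> 'I_d -> R) u :
  (forall i, measurable_fun setT (fun w => x w i)) ->
  measurable [set w | argmin_action S (x w) = u].
Proof.
move=> mx.
pose g (c : {ffun action d * action d -> bool}) : action d :=
  odflt (some_action S) [pick v in S | [forall (w | w \in S), c (v, w)]].
rewrite [X in measurable X](_ : _ = [set w | g [ffun vw : action d * action d =>
    dotp vw.1 (x w) <= dotp vw.2 (x w)] = u]); last first.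
  apply/seteqP; split => w /= <-; rewrite argmin_pick /g; congr odflt;
    apply: eq_pick => v /=; congr andb; apply: eq_forallb => v'; rewrite ffunE//.
apply: (@measurable_fin_fun _ _ _ _
  (fun w (vw : action d * action d) => dotp vw.1 (x w) <= dotp vw.2 (x w))).
move=> [v v']/=.
have md (v0 : action d) : measurable_fun setT (fun w => dotp v0 (x w)).
  by apply: measurable_sum => i; apply: measurable_funM.
by apply: measurable_setb; exact: measurable_fun_ler.
Qed.

End argmin.

(** * The exponential law *)

Section exponential_law.
Context {R : realType}.
Local Notation mu := (@lebesgue_measure R).

Lemma lebesgue_measure_shift (c : R) (A : set R) : measurable A ->
  pushforward mu (fun x : R => x + c : measurableTypeR R) A = mu A.
Proof.
move=> mA; apply/esym; apply: lebesgue_measure_unique => //=.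
  exact: measurable_funD.
move=> mshift _ [[a b]] _ <-; rewrite /pushforward.
rewrite (_ : _ @^-1` _ = `]a - c, b - c]%classic); last first.
  by apply/seteqP; split => x /=; rewrite !in_itv/= ltrBlDr lerBrDr.
rewrite !lebesgue_measure_itv/= !lte_fin ltrD2r.
by case: ifP => // _; rewrite -!EFinB opprB addrA subrK.
Qed.

Lemma exponential_prob_setT : exponential_prob 1 [set: R] = 1%E.
Proof. exact: (integral_exponential_pdf ltr01). Qed.

(** Memorylessness: translate by [c] and factor [exp (- c)] out of the density. Points of [A] below
    0 are excluded on the left and have density 0 on the right. *)
Lemma exponential_prob_shift (c : R) (A : set R) : 0 <= c -> measurable A ->
  exponential_prob 1 [set x | c <= x /\ A (x - c)]
  = ((expR (- c))%:E * exponential_prob 1 A)%E.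
Proof.
move=> c0 mA.
have mpdf : measurable_fun setT (EFin \o @exponential_pdf R 1).
  by apply/measurable_EFinP; exact: measurable_exponential_pdf.
have pdf0 x : (0 <= (@exponential_pdf R 1 x)%:E)%E.
  by rewrite lee_fin exponential_pdf_ge0.
have mD : measurable [set x | c <= x /\ A (x - c)].
  rewrite (_ : [set x | _] = `[c, +oo[%classic `&` (fun x => x - c) @^-1` A).
    apply: measurableI => //; rewrite -[X in measurable X]setTI.
    have mB : measurable_fun setT (fun x : R => x - c) by exact: measurable_funD.
    exact: mB.
  by apply/seteqP; split => x /=; rewrite in_itv/= andbT.
have mshift : measurable_fun [set: R] (fun x : R => x + c : measurableTypeR R).
  exact: measurable_funD.
transitivity (\int[pushforward mu (fun x : R => (x + c)%R : measurableTypeR R)]_(x in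
    [set x | (c <= x)%R /\ A (x - c)%R]) (exponential_pdf 1 x)%:E)%E.
  rewrite /exponential_prob; apply: eq_measure_integral => B mB _.
  exact/esym/lebesgue_measure_shift.
rewrite ge0_integral_pushforward//; last exact: measurable_funTS.
rewrite (_ : _ @^-1` _ = A `&` `[0, +oo[); last first.
  apply/seteqP; split => x /=; rewrite in_itv/= andbT addrK lerDr; tauto.
transitivity (\int[mu]_(x in A `&` `[0%R, +oo[) ((expR (- c))%:E * (exponential_pdf 1 x)%:E))%E.
  apply: eq_integral => x; rewrite inE/= in_itv/= andbT => -[_ x0].
  rewrite !exponential_pdfE ?addr_ge0// -EFinM; congr (_%:E).
  by rewrite !mul1r !mulN1r opprD expRD mulrC.
rewrite ge0_integralZl//; last 2 first.
- exact: measurableI.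
- exact: measurable_funTS.
congr (_ * _)%E; rewrite /exponential_prob integral_mkcondr.
apply: eq_integral => x _; rewrite patchE; case: ifPn => //.
rewrite notin_setE/= in_itv/= andbT => /negP; rewrite -ltNge => x0.
by rewrite lt0_exponential_pdf.
Qed.

Context {dO} {Omega : measurableType dO} {P : probability Omega R}.

(** The tail bound [P (X - c > r) <= exp (- c) * exp (- r)] is integrated over [r >= 0]. *)
Lemma expectation_excess_le (X : Omega -> R) (c : R) : 0 <= c ->
    measurable_fun setT X ->
    (forall A, measurable A -> P [set w | A (X w)] = exponential_prob 1 A) ->
  (\int[P]_w (Num.max 0 (X w - c))%:E <= (expR (- c))%:E)%E.
Proof.
move=> c0 mX PX.
have mY : measurable_fun setT (fun w => Num.max 0 (X w - c)).
  by apply: measurable_maxr => //; exact: measurable_funB.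
pose Y : {RV P >-> R} := HB.pack (fun w => Num.max 0 (X w - c))
  (isMeasurableFun.Build _ _ _ _ _ mY).
have Y0 w : 0 <= Y w by rewrite /= le_max lexx.
rewrite (_ : \int[P]_w _ = 'E_P[Y])%E; last by rewrite unlock.
rewrite (ge0_expectation_ccdf Y0).
have mpdf : measurable_fun setT (EFin \o @exponential_pdf R 1).
  by apply/measurable_EFinP; exact: measurable_exponential_pdf.
have -> : (expR (- c))%:E = (\int[mu]_(r in `[0%R, +oo[) ((expR (- c))%:E * (exponential_pdf 1 r)%:E))%E.
  rewrite ge0_integralZl//; last 2 first.
  - exact: measurable_funTS.
  - by move=> x _; rewrite lee_fin exponential_pdf_ge0.
  rewrite -[LHS]mule1; congr (_ * _)%E; rewrite -exponential_prob_setT.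
  rewrite /exponential_prob [RHS]integral_mkcond; apply: eq_integral => x _.
  rewrite patchE; case: ifPn => //; rewrite notin_setE/= in_itv/= andbT => /negP.
  by rewrite -ltNge => x0; rewrite lt0_exponential_pdf.
apply: ge0_le_integral => //.
- exact: measurable_funTS (ccdf_measurable Y).
- by apply: measurable_funeM; exact: measurable_funTS.
move=> r; rewrite /= in_itv/= andbT => r0.
apply: (@le_trans _ _ (P [set w | X w \in `[c + r, +oo[])).
  rewrite /ccdf /distribution /pushforward; apply: le_measure; rewrite ?inE.
  - by rewrite -[X in measurable X]setTI; exact: (mY).
  - by rewrite -[X in measurable X]setTI; apply: (mX _ `[c + r, +oo[%classic).
  - move=> w /=; rewrite !in_itv/= !andbT lt_max => /orP[|].
      by rewrite ltNge r0.
    by rewrite ltrBrDl => /ltW.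
rewrite (PX `[c + r, +oo[%classic)//.
have -> : `[c + r, +oo[%classic = [set x : R | c + r <= x /\ [set: R] (x - (c + r))].
  by apply/seteqP; split => x /=; rewrite in_itv/= andbT; tauto.
rewrite exponential_prob_shift ?addr_ge0// exponential_prob_setT mule1.
by rewrite exponential_pdfE// -EFinM lee_fin mul1r mulN1r opprD expRD.
Qed.

(** Perturbations are nonnegative only almost surely, so pointwise inequalities carry their negative
    parts until these are integrated away. *)
Lemma expectation_negpart_le0 (X : Omega -> R) :
    measurable_fun setT X ->
    (forall A, measurable A -> P [set w | A (X w)] = exponential_prob 1 A) ->
  (\int[P]_w (Num.max 0 (- X w))%:E <= 0)%E.
Proof.
move=> mX PX.
have mY : measurable_fun setT (fun w => Num.max 0 (- X w)).
  by apply: measurable_maxr => //; exact: measurable_funN.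
rewrite le_eqVlt; apply/orP; left; apply/eqP.
rewrite (ae_eq_integral (cst 0%E))//; first by rewrite integral0.
- by apply/measurable_EFinP.
- exists [set w | X w \in `]-oo, 0[]; split.
  + by rewrite -[X in measurable X]setTI; apply: (mX _ `]-oo, 0[%classic).
  + transitivity (exponential_prob 1 (`]-oo, 0[%classic : set R)); first exact: PX.
    rewrite /exponential_prob integral0_eq// => x/=.
    by rewrite in_itv/= => /lt0_exponential_pdf ->.
  + move=> w /= h; rewrite in_itv/= ltNge; apply/negP => Xw; apply: h => _.
    by rewrite max_l// oppr_le0.
Qed.

End exponential_law.

(** * Follow the perturbed leader *)

Section vectors.
Context {R : realType} {I : finType}.

Definition rectangles : set (set (I -> R)) :=
  [set C | exists2 A : I -> set R, (forall i, measurable (A i)) &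
     C = [set x | forall i, A i (x i)]].

(** The product sigma-algebra, presented through its pi-system of rectangles so that laws of
    perturbation vectors can be compared there. *)
Definition vectors : Type := g_sigma_algebraType rectangles.
HB.instance Definition _ := Measurable.on vectors.

Lemma rectangles_setI : setI_closed rectangles.
Proof.
move=> _ _ [A mA ->] [B mB ->]; exists (fun i => A i `&` B i).
  by move=> i; exact: measurableI.
by apply/seteqP; split => x /= => [[h1 h2] i|h]; [split|split => i; have [] := h i].
Qed.

Lemma rectangles_setT : rectangles setT.
Proof. by exists (fun=> setT) => //; apply/seteqP; split. Qed.

Lemma measurable_vector {dO} {Omega : measurableType dO} (X : Omega -> I -> R) :
  (forall i, measurable_fun setT (fun w => X w i)) ->
  measurable_fun setT (X : Omega -> vectors).
Proof.
move=> mX; apply: (@measurability _ _ _ vectors _ _ rectangles) => // _ [_ [A mA ->] <-].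
rewrite setTI; apply: (@measurable_forall_fin _ _ _ (fun i => (fun w => X w i) @^-1` A i)).
by move=> i; rewrite -[X in measurable X]setTI; exact: mX.
Qed.

Lemma measurable_coord i : measurable_fun setT (fun x : vectors => x i).
Proof.
move=> _ A mA; rewrite setTI; apply: sub_sigma_algebra.
exists (fun j => if j == i then A else setT); first by move=> j; case: ifP.
apply/seteqP; split => x /= => [h j|/(_ i)]; last by rewrite eqxx.
by case: ifP => // /eqP ->.
Qed.

End vectors.

Section exponential_vector.
Context {R : realType} {I : finType}.
Context {dO} {Omega : measurableType dO} {P : probability Omega R}.
Variable X : Omega -> I -> R.
Hypothesis mX : forall i, measurable_fun setT (fun w => X w i).

Definition iid_exponential := forall A : I -> set R,
  (forall i, measurable (A i)) ->
  P [set w | forall i, A i (X w i)] = (\prod_i exponential_prob 1 (A i))%E.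

Hypothesis hX : iid_exponential.

Lemma iid_exponential_coord i A : measurable A ->
  P [set w | A (X w i)] = exponential_prob 1 A.
Proof.
move=> mA; have := hX (A := fun j => if j == i then A else setT).
rewrite (bigD1 i)//= eqxx big1 ?mule1 => [<-|j /negbTE ->]; last 2 first.
- by move=> j; case: ifP.
- exact: exponential_prob_setT.
congr (P _); apply/seteqP; split => w /= => [h j|/(_ i)]; last by rewrite eqxx.
by case: ifP => // /eqP ->.
Qed.

(** Both sides are finite measures in [E], and on rectangles they are products of one-dimensional
    memoryless identities. *)
Lemma exponential_vector_shift (c : I -> R) (E : set (@vectors R I)) :
    (forall i, 0 <= c i) -> measurable E ->
  P [set w | (forall i, c i <= X w i) /\ E (fun i => X w i - c i)]
  = ((expR (- \sum_i c i))%:E * P [set w | E (X w)])%E.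
Proof.
move=> c0 mE.
have mD : measurable [set w | forall i, c i <= X w i].
  apply: (@measurable_forall_fin _ _ _ (fun i => [set w | c i <= X w i])) => i.
  by apply: measurable_setb; exact: measurable_fun_ler.
have mXc i : measurable_fun setT (fun w => X w i - c i) by exact: measurable_funB.
pose m1 := pushforward (mrestr P mD) ((fun w i => X w i - c i) : Omega -> @vectors R I).
pose m1' := measure_function_pushforward__canonical__measure_function_Measure
  (mrestr P mD) (measurable_vector mXc).
pose m2 := mscale (NngNum (expR_ge0 (- \sum_i c i)))
  (measure_function_pushforward__canonical__measure_function_Measure
  P (measurable_vector mX)).
have eqE : forall A, <<s @rectangles R I >> A -> m1' A = m2 A.
  apply: (@measure_eq_g_sigma _ (@vectors R I) R rectangles m1' m2).
  - by move=> A rA; exact: sub_sigma_algebra.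
  - exact: rectangles_setI.
  - exact: rectangles_setT.
  - have le1 : (P (setT `&` [set w | (forall i, c i <= X w i)%R]) <= 1)%E.
      by rewrite probability_le1// setTI.
    exact: le_lt_trans le1 (ltry _).
  move=> _ [A mA ->].
  rewrite /m1' /m2 /mscale /pushforward /mrestr/=.
  transitivity (P [set w | forall i, [set x | c i <= x /\ A i (x - c i)] (X w i)]).
    congr (P _); apply/seteqP; split => w /= => [[h1 h2] i|h]; first by split.
    by split => i; have [] := h i.
  rewrite (hX (A := fun i => [set x | c i <= x /\ A i (x - c i)])); last first.
    move=> i; have mB : measurable_fun setT (fun x : R => x - c i) by exact: measurable_funB.
    rewrite (_ : [set x | _] = `[c i, +oo[%classic `&` (fun x => x - c i) @^-1` A i).
      by apply: measurableI => //; rewrite -[X in measurable X]setTI; exact: mB.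
    by apply/seteqP; split => x /=; rewrite in_itv/= andbT.
  rewrite (eq_bigr (fun i => (expR (- c i))%:E * exponential_prob 1 (A i))%E); last first.
    by move=> i _; exact: exponential_prob_shift.
  rewrite big_split/= prodEFin -expR_sum sumrN; congr (_ * _)%E.
  by rewrite -hX.
have := eqE E mE; rewrite /m1' /m2 /mscale /pushforward /mrestr/= => <-.
by congr (P _); apply/seteqP; split => w /= [].
Qed.

Lemma same_law {dO'} {Omega' : measurableType dO'} {P' : probability Omega' R}
    (X' : Omega' -> I -> R) (E : set (@vectors R I)) :
    (forall i, measurable_fun setT (fun w => X' w i)) ->
    (forall A : I -> set R, (forall i, measurable (A i)) ->
      P' [set w | forall i, A i (X' w i)] = (\prod_i exponential_prob 1 (A i))%E) ->
    measurable E ->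
  P [set w | E (X w)] = P' [set w | E (X' w)].
Proof.
move=> mX' hX' mE.
pose m1 := measure_function_pushforward__canonical__measure_function_Measure
  P (measurable_vector mX).
pose m2 := measure_function_pushforward__canonical__measure_function_Measure
  P' (measurable_vector mX').
apply: (@measure_eq_g_sigma _ (@vectors R I) R rectangles m1 m2) => //.
- by move=> A rA; exact: sub_sigma_algebra.
- exact: rectangles_setI.
- exact: rectangles_setT.
- by rewrite /m1/= /pushforward probability_setT ltry.
- by move=> _ [A mA ->]; rewrite /m1 /m2/= /pushforward/=; rewrite hX'// hX.
Qed.

End exponential_vector.

Arguments iid_exponential {R I dO Omega} P X.

(** * The leader along a frozen path of estimates *)

Section follow_the_perturbed_leader.
Context {R : realType} {d : nat} {S : {set action d}} {eta : R}.
Context {dO} {Omega : measurableType dO} {P : probability Omega R}.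
Variable X : Omega -> 'I_d -> R.
Hypothesis S0 : S != finset.set0.
Hypothesis eta_gt0 : 0 < eta.
Hypothesis mX : forall i, measurable_fun setT (fun w => X w i).
Hypothesis hX : iid_exponential P X.

Definition play_prob (L : 'I_d -> R) (u : action d) : R :=
  fine (P [set w | fpl_action S eta L (X w) = u]).

(** The source space is left arbitrary: it will also be a sub-sigma-algebra or a product space. *)
Lemma measurable_fpl_action {d'} {T : measurableType d'} (L x : T -> 'I_d -> R) u :
    (forall i, measurable_fun setT (fun w => L w i)) ->
    (forall i, measurable_fun setT (fun w => x w i)) ->
  measurable [set w | fpl_action S eta (L w) (x w) = u].
Proof.
move=> mL mx; apply: (@measurable_argmin _ _ _ _ _ (fun w i => eta * L w i - x w i)) => i.
by apply: measurable_funB => //; exact: measurable_funM.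
Qed.

Lemma measurable_fpl_vectors (L : 'I_d -> R) u :
  measurable [set x : @vectors R 'I_d | fpl_action S eta L x = u].
Proof.
by apply: (@measurable_fpl_action _ (@vectors R 'I_d) (fun=> L) id) => // i; exact: measurable_coord.
Qed.

Lemma play_prob_ge0 L u : 0 <= play_prob L u.
Proof. exact: fine_ge0. Qed.

Lemma play_prob_sum1 L : \sum_u play_prob L u = 1.
Proof. by apply: sum_fin_valued => u; exact: measurable_fpl_action. Qed.

Lemma play_prob_supp L u : play_prob L u != 0 -> u \in S.
Proof.
apply: contra_neqT => uS; rewrite /play_prob (_ : [set w | _] = set0) ?measure0//.
apply/seteqP; split => // w /= wu; move: uS; rewrite -wu.
by have [-> _] := argminP S0 (fun i => eta * L i - X w i).
Qed.

(* Raising by [eta * l i] the perturbations of the coordinates chosen by [u]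
   compensates the loss [l] for [u] and can only hurt the other actions. *)
Lemma play_prob_discount (L l : 'I_d -> R) u : (forall i, 0 <= l i) ->
  play_prob L u * expR (- (eta * dotp u l)) <= play_prob (fun i => L i + l i) u.
Proof.
move=> l0; pose c i := eta * ((u i)%:R * l i).
have c0 i : 0 <= c i by rewrite mulr_ge0 ?(ltW eta_gt0)// mulr_ge0.
have shift := exponential_vector_shift mX hX c0 (measurable_fpl_vectors L u).
rewrite -mulr_sumr -/(dotp u l) in shift.
have mE := @measurable_fpl_action _ _ (fun=> L) X u (fun i => measurable_cst _) mX.
have mE' := @measurable_fpl_action _ _ (fun=> (fun i => L i + l i)) X u (fun i => measurable_cst _) mX.
have fE : P [set w | fpl_action S eta L (X w) = u] \is a fin_num by rewrite fin_num_measure.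
rewrite /play_prob -lee_fin EFinM !fineK ?fin_num_measure// muleC -shift.
apply: le_measure; rewrite ?inE//.
  apply: measurableI.
    apply: (@measurable_forall_fin _ _ _ (fun i => [set w | c i <= X w i])) => i.
    by apply: measurable_setb; exact: measurable_fun_ler.
  have mXc i : measurable_fun setT (fun w => X w i - c i) by exact: measurable_funB.
  exact: (@measurable_fpl_action _ _ (fun=> L) (fun w i => X w i - c i)).
move=> w /= [_]; rewrite /fpl_action => /argmin_raise; apply=> //.
  by apply: eq_bigr => i _; rewrite /c; case: (u i) => /=; ring.
move=> v; apply: ler_sum => i _; rewrite ler_wpM2l// /c.
have := mulr_ge0 (ltW eta_gt0) (l0 i).
by case: (u i); rewrite ?mul1r ?mul0r; lra.
Qed.

(** One perturbation [x] serves all rounds. It acts as the loss [- x] of a fictitious initial round,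
    whence the terms in [x] for [v] and for the first leader. *)
Lemma be_the_leader (L_ l_ : nat -> 'I_d -> R) (x : 'I_d -> R) n v : v \in S ->
    (forall i, L_ 0%N i = 0) -> (forall t i, L_ t.+1 i = L_ t i + l_ t i) ->
  \sum_(t < n) eta * dotp (fpl_action S eta (L_ t.+1) x) (l_ t)
  <= eta * dotp v (L_ n) - dotp v x + dotp (fpl_action S eta (L_ 0%N) x) x.
Proof.
move=> vS L0 LS; pose a t := fpl_action S eta (L_ t) x.
pose y t i := eta * L_ t i - x i.
have dotpy w t : dotp w (y t) = eta * dotp w (L_ t) - dotp w x.
  by rewrite -dotpZ /dotp -sumrB; apply: eq_bigr => i _; rewrite mulrBr.
have aS t : a t \in S by have [] := argminP S0 (y t).
have amin t w : w \in S -> dotp (a t) (y t) <= dotp w (y t).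
  by have [_] := argminP S0 (y t); exact.
(* The induction compares with the current leader, whose minimality can be used at each step; [v]
   enters only at the end. *)
have : \sum_(t < n) eta * dotp (a t.+1) (l_ t) <= dotp (a n) (y n) + dotp (a 0%N) x.
  elim: n => [|n IHn].
    rewrite big_ord0 dotpy (_ : dotp _ (L_ 0%N) = 0) ?mulr0 ?sub0r ?addNr//.
    by rewrite /dotp big1// => i _; rewrite L0 mulr0.
  rewrite big_ord_recr/= (le_trans (lerD IHn (lexx _)))//.
  rewrite addrAC lerD2r; apply: (le_trans (lerD (amin n _ (aS n.+1)) (lexx _))).
  rewrite !dotpy (_ : dotp _ (L_ n.+1) = dotp (a n.+1) (L_ n) + dotp (a n.+1) (l_ n)).
    by rewrite mulrDr; lra.
  by rewrite -dotpD; apply: eq_bigr => i _; rewrite LS.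
by move/le_trans; apply; rewrite lerD2r -dotpy amin.
Qed.

Variable m : nat.
Hypothesis m_gt0 : (0 < m)%N.
Hypothesis m_le_d : (m <= d)%N.
Hypothesis Sm : forall v, v \in S -> (\sum_(i < d) v i <= m)%N.

(** [L_] and [l_] are arbitrary deterministic sequences, so the bound applies to each realized path;
    only [X] is integrated. *)
Lemma fpl_regret (L_ l_ : nat -> 'I_d -> R) n v : v \in S ->
    (forall i, L_ 0%N i = 0) -> (forall t i, L_ t.+1 i = L_ t i + l_ t i) ->
    (forall t i, 0 <= l_ t i) ->
  \sum_(t < n) discounted_loss (play_prob (L_ t)) eta (l_ t)
  <= dotp v (L_ n) + m%:R * (ln (d%:R / m%:R) + 1) / eta.
Proof.
move=> vS L0 LS l0.
(* The level at which [d * exp (- lam) = m]: the leader collects at most [m * lam] below it, and the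
   excesses of all [d] coordinates above it have total mean at most [m]. *)
set lam := ln (d%:R / m%:R).
have lam0 : 0 <= lam.
  by rewrite ln_ge0// ler_pdivlMr ?ltr0n// mul1r ler_nat.
have lamd : d%:R * expR (- lam) = m%:R :> R.
  have d0 : (0 < d)%N by exact: leq_trans m_le_d.
  rewrite expRN lnK ?posrE ?divr_gt0 ?ltr0n// invf_div mulrCA divff ?mulr1//.
  by rewrite pnatr_eq0 -lt0n.
have mplay t u : measurable [set w | fpl_action S eta (L_ t) (X w) = u].
  exact: (@measurable_fpl_action _ _ (fun=> L_ t)).
have step1 : \sum_(t < n) discounted_loss (play_prob (L_ t)) eta (l_ t)
    <= \sum_(t < n) \sum_u dotp u (l_ t) * play_prob (L_ t.+1) u.
  apply: ler_sum => t _; apply: ler_sum => u _.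
  rewrite mulrA mulrC ler_wpM2l ?dotp_ge0//.
  apply: le_trans (play_prob_discount _ _ (l0 t)) _.
  rewrite le_eqVlt; apply/orP; left; apply/eqP; congr (play_prob _ _).
  by apply/funext => i; rewrite LS.
apply: le_trans step1 _.
(* Nonnegativity of the constant keeps every integral below one of a nonnegative function. *)
have c0 : 0 <= eta * dotp v (L_ n) + m%:R * lam.
  rewrite addr_ge0 ?mulr_ge0 ?(ltW eta_gt0)// dotp_ge0// => i.
  elim: n => [|n IHn]; first by rewrite L0.
  by rewrite LS addr_ge0.
have mterm t : measurable_fun setT
    (fun w => (eta * dotp (fpl_action S eta (L_ t.+1) (X w)) (l_ t))%:E).
  apply/measurable_EFinP; apply: (@measurable_fin_comp _ _ _ _ _
    (fun w => fpl_action S eta (L_ t.+1) (X w)) (fun u => eta * dotp u (l_ t))).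
  by move=> u; exact: mplay.
have mexc i : measurable_fun setT (fun w => (Num.max 0 (X w i - lam))%:E).
  by apply/measurable_EFinP; apply: measurable_maxr => //; exact: measurable_funB.
have mneg i : measurable_fun setT (fun w => (Num.max 0 (- X w i))%:E).
  by apply/measurable_EFinP; apply: measurable_maxr => //; exact: measurable_funN.
have exc0 w i : (0 <= (Num.max 0 (X w i - lam))%:E)%E by rewrite lee_fin le_max lexx.
have neg0 w i : (0 <= (Num.max 0 (- X w i))%:E)%E by rewrite lee_fin le_max lexx.
have key : (\int[P]_w (\sum_(t < n) (eta * dotp (fpl_action S eta (L_ t.+1) (X w)) (l_ t))%:E)
  <= \int[P]_w ((eta * dotp v (L_ n) + m%:R * lam)%:E +
     \sum_(i < d) ((Num.max 0 (X w i - lam))%:E + (Num.max 0 (- X w i))%:E)))%E.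
  apply: ge0_le_integral => //.
  - move=> w _; apply: sume_ge0 => t _; rewrite lee_fin mulr_ge0 ?(ltW eta_gt0)//.
    exact: dotp_ge0.
  - exact: emeasurable_sum.
  - apply: emeasurable_funD => //; apply: emeasurable_sum => i.
    exact: emeasurable_funD.
  move=> w _.
  have := be_the_leader (X w) n vS L0 LS.
  set a := fpl_action S eta (L_ 0%N) (X w).
  have aS : a \in S by have [] := argminP S0 (fun i => eta * L_ 0%N i - X w i).
  have h1 : dotp a (X w) <= m%:R * lam + \sum_(i < d) Num.max 0 (X w i - lam).
    apply: (@le_trans _ _ (dotp a (fun=> lam) + \sum_(i < d) Num.max 0 (X w i - lam))).
      rewrite /dotp -big_split/=; apply: ler_sum => i _.
      have h2 : 0 <= Num.max 0 (X w i - lam) by rewrite le_max lexx.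
      have h3 : X w i - lam <= Num.max 0 (X w i - lam) by rewrite le_max lexx orbT.
      by case: (a i); rewrite ?mul1r ?mul0r; lra.
    by rewrite lerD2r dotp_le_cst// Sm.
  have h2 : - dotp v (X w) <= \sum_(i < d) Num.max 0 (- X w i).
    rewrite /dotp -sumrN; apply: ler_sum => i _.
    have h2 : 0 <= Num.max 0 (- X w i) by rewrite le_max lexx.
    have h3 : - X w i <= Num.max 0 (- X w i) by rewrite le_max lexx orbT.
    by case: (v i); rewrite ?mul1r ?mul0r; lra.
  rewrite sumEFin (eq_bigr (fun i => (Num.max 0 (X w i - lam) + Num.max 0 (- X w i))%:E))//.
  rewrite sumEFin -EFinD lee_fin big_split/=.
  by move=> h; lra.
have : (\int[P]_w (\sum_(t < n) (eta * dotp (fpl_action S eta (L_ t.+1) (X w)) (l_ t))%:E)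
   = (eta * \sum_(t < n) \sum_u dotp u (l_ t) * play_prob (L_ t.+1) u)%:E)%E.
  rewrite ge0_integral_sum//; last first.
    by move=> t w _; rewrite lee_fin mulr_ge0 ?(ltW eta_gt0)// dotp_ge0.
  rewrite mulr_sumr -sumEFin; apply: eq_bigr => t _.
  rewrite (@integral_fin_valued _ _ _ P _ (fun w => fpl_action S eta (L_ t.+1) (X w))
    (fun u => eta * dotp u (l_ t))) => [|u|u].
  - by congr (_%:E); rewrite mulr_sumr; apply: eq_bigr => u _; rewrite mulrA.
  - exact: mplay.
  - by rewrite mulr_ge0 ?(ltW eta_gt0)// dotp_ge0.
have : (\int[P]_w ((eta * dotp v (L_ n) + m%:R * lam)%:E +
     \sum_(i < d) ((Num.max 0 (X w i - lam))%:E + (Num.max 0 (- X w i))%:E))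
  <= (eta * dotp v (L_ n) + m%:R * lam + m%:R)%:E)%E.
  rewrite ge0_integralD//; last 2 first.
  - by move=> w _; apply: sume_ge0 => i _; rewrite adde_ge0.
  - by apply: emeasurable_sum => i; exact: emeasurable_funD.
  rewrite integral_cst// [X in (_ * X)%E](probability_setT P) mule1 [leRHS]EFinD.
  rewrite leeD2lE// ge0_integral_sum//; last 2 first.
  - by move=> i; exact: emeasurable_funD.
  - by move=> i w _; rewrite adde_ge0.
  rewrite -lamd mulr_natl -[X in _ *+ X](card_ord d) -sumr_const -sumEFin.
  apply: lee_sum => i _; rewrite ge0_integralD// -[leRHS]adde0 leeD//.
    apply: expectation_excess_le => // A mA; exact: iid_exponential_coord.
  apply: expectation_negpart_le0 => // A mA; exact: iid_exponential_coord.
move=> h2 h1; have := le_trans key h2; rewrite h1 lee_fin => h.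
have -> : dotp v (L_ n) + m%:R * (lam + 1) / eta =
   eta^-1 * (eta * dotp v (L_ n) + m%:R * lam + m%:R) by field; rewrite gt_eqF.
by rewrite ler_pdivlMl.
Qed.

End follow_the_perturbed_leader.

(** * Independence *)

Section grouping.
Context {dO} {Omega : measurableType dO} {R : realType} {P : probability Omega R}.

(** Only full products are required; when each [C b] contains [setT], subfamilies are included. *)
Definition product_rule (B : finType) (C : B -> set (set Omega)) : Prop :=
  forall A : B -> set Omega, (forall b, C b (A b)) ->
  P [set w | forall b, A b w] = (\prod_b P (A b))%E.

Lemma product_rule_g_sigma (B : finType) (C : B -> set (set Omega)) :
    (forall b, C b `<=` measurable) -> (forall b, setI_closed (C b)) ->
    (forall b, C b setT) ->
  product_rule C -> product_rule (fun b => <<s C b >>).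
Proof.
move=> Cm CI CT prC A sA.
have sm b X : <<s C b >> X -> measurable X.
  by apply: smallest_sub; [exact: sigma_algebra_measurable|exact: Cm].
(* Indices are upgraded to their sigma-algebras one at a time; [s] lists those already upgraded. *)
suff : forall (s : seq B) (A : B -> set Omega), (forall b, b \in s -> <<s C b >> (A b)) ->
    (forall b, b \notin s -> C b (A b)) ->
    P [set w | forall b, A b w] = (\prod_b P (A b))%E.
  by move/(_ (index_enum B) A); apply => // b; rewrite mem_index_enum.
elim=> [|b0 s IHs] {sA}A sA cA; first by apply: prC => b; exact: cA.
have [b0s|b0s] := boolP (b0 \in s).
  apply: IHs => b bs; first by apply: sA; rewrite inE bs orbT.
  by apply: cA; rewrite inE negb_or bs andbT; apply: contraNneq bs => ->.
pose upd X b := if b == b0 then X else A b.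
pose E := [set w | forall b, b != b0 -> A b w].
have mA b : measurable (A b).
  by have [/sA/sm|/cA/Cm] := boolP (b \in b0 :: s).
have mE : measurable E.
  rewrite [X in measurable X](_ : _ = [set w | forall b, (upd setT b) w]).
    by apply: measurable_forall_fin => b; rewrite /upd; case: ifP.
  apply/seteqP; split => w /= h b; first by rewrite /upd; case: eqP => // /eqP/h.
  by move=> /negbTE bb; have := h b; rewrite /upd bb.
have updE X : [set w | forall b, upd X b w] = X `&` E.
  apply/seteqP; split => w /= => [h|[Xw h] b].
    split; first by have := h b0; rewrite /upd eqxx.
    by move=> b /negbTE bb; have := h b; rewrite /upd bb.
  by rewrite /upd; case: eqP => // /eqP/h.
have prU X : (\prod_b P (upd X b) = P X * \prod_(b | b != b0) P (A b))%E.
  rewrite (bigD1 b0)//= /upd eqxx; congr (_ * _)%E.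
  by apply: eq_bigr => b /negbTE ->.
have IH X : C b0 X -> (P (X `&` E) = P X * \prod_(b | b != b0) P (A b))%E.
  move=> CX; rewrite -updE -prU; apply: IHs => b bs.
    rewrite /upd; case: eqP => [->|_]; first exact: sub_sigma_algebra.
    by apply: sA; rewrite inE bs orbT.
  rewrite /upd; case: eqP => [->//|/eqP bb].
  by apply: cA; rewrite inE negb_or bb.
have PE : (P E = \prod_(b | b != b0) P (A b))%E.
  have := IH setT (CT b0); rewrite setTI => ->.
  by rewrite [X in (X * _)%E](probability_setT P) mul1e.
have fE : P E \is a fin_num by rewrite fin_num_measure.
have fE0 : 0 <= fine (P E) by exact: fine_ge0.
have -> : [set w | forall b, A b w] = A b0 `&` E.
  rewrite -updE; apply/seteqP; split => w /= h b; have := h b; rewrite /upd.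
    by case: eqP => [->|].
  by case: eqP => [->|].
rewrite (bigD1 b0)//= -PE.
(* As functions of the event at [b0], both sides are finite measures that agree on the pi-system
   [C b0]. *)
have key : mrestr P mE (A b0) = mscale (NngNum fE0) P (A b0).
  apply: (@measure_eq_g_sigma _ Omega R (C b0) (mrestr P mE) (mscale (NngNum fE0) P)) => //.
  - have le1 : (P (setT `&` E) <= 1)%E by rewrite probability_le1// setTI.
    exact: le_lt_trans le1 (ltry _).
  - move=> X CX; change (P (X `&` E) = (fine (P E))%:E * P X)%E.
    by rewrite fineK// IH// PE muleC.
  - by apply: sA; rewrite inE eqxx.
change (P (A b0 `&` E) = (fine (P E))%:E * P (A b0))%E in key.
by rewrite key fineK// muleC.
Qed.

Context {J : finType}.
Variable F : J -> set (set Omega).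
Hypothesis F_meas : forall j, F j `<=` measurable.
Hypothesis F_setI : forall j, setI_closed (F j).
Hypothesis F_setT : forall j, F j setT.
Hypothesis F_indep : product_rule F.

(** A pi-system generating the join of the [F j] with [j] in [Q]: this is how several sources are
    grouped into one sigma-algebra. *)
Definition cylinders (Q : pred J) : set (set Omega) :=
  [set C | exists A : J -> set Omega, [/\ forall j, F j (A j),
     forall j, ~~ Q j -> A j = setT & C = [set w | forall j, A j w]]].

Lemma cylinders_measurable Q : cylinders Q `<=` measurable.
Proof.
by move=> _ [A [FA _ ->]]; apply: measurable_forall_fin => j; exact: F_meas (FA j).
Qed.

Lemma cylinders_setI Q : setI_closed (cylinders Q).
Proof.
move=> _ _ [A [FA QA ->]] [B [FB QB ->]]; exists (fun j => A j `&` B j); split.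
- by move=> j; exact: F_setI.
- by move=> j Qj; rewrite QA// QB// setTI.
- by apply/seteqP; split => w /= => [[h1 h2] j|h]; [split|split => j; have [] := h j].
Qed.

Lemma cylinders_setT Q : cylinders Q setT.
Proof. by exists (fun=> setT); split => //; apply/seteqP; split. Qed.

Lemma cylinders_sub (Q Q' : pred J) : (forall j, Q j -> Q' j) ->
  cylinders Q `<=` cylinders Q'.
Proof.
move=> QQ' _ [A [FA QA ->]]; exists A; split => // j Qj.
by apply: QA; apply: contra Qj => /QQ'.
Qed.

Lemma cylinders_one (Q : pred J) j A : Q j -> F j A -> cylinders Q A.
Proof.
move=> Qj FA; exists (fun i => if i == j then A else setT); split.
- by move=> i; case: eqP => [->|].
- by move=> i; case: eqP => // ->; rewrite Qj.
- apply/seteqP; split => w /= => [h i|/(_ j)]; last by rewrite eqxx.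
  by case: ifP.
Qed.

Lemma cylinders_indep (B : finType) (Q : B -> pred J) :
    (forall b b' j, Q b j -> Q b' j -> b = b') ->
  product_rule (fun b => <<s cylinders (Q b) >>).
Proof.
move=> disj; apply: product_rule_g_sigma.
- by move=> b; exact: cylinders_measurable.
- by move=> b; exact: cylinders_setI.
- by move=> b; exact: cylinders_setT.
move=> C /choice[A hA].
have FA b j : F j (A b j) by have [] := hA b.
have QA b j : ~~ Q b j -> A b j = setT by have [_ + _] := hA b; exact.
have CA b : C b = [set w | forall j, A b j w] by have [] := hA b.
have alone j b : Q b j -> forall b', b' != b -> A b' j = setT.
  by move=> Qb b' bb; apply: QA; apply: contra bb => /disj/(_ Qb) ->.
(* Each source belongs to at most one group, so [D j] is again an event of [F j] and the product
   over sources can be regrouped. *)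
pose D j := [set w | forall b, A b j w].
have DP j : F j (D j) /\ P (D j) = (\prod_b P (A b j))%E.
  have [/existsP[b Qb]|] := boolP [exists b, Q b j].
    have -> : D j = A b j.
      apply/seteqP; split => w /= => [|Aw b']; first exact.
      by have [->//|/(alone _ _ Qb)->] := eqVneq b' b.
    split=> //; rewrite (bigD1 b)//= big1 ?mule1// => b' /(alone _ _ Qb)->.
    by rewrite -[RHS](probability_setT P).
  rewrite negb_exists => /forallP nQ.
  have AT b : A b j = setT by exact/QA/nQ.
  have -> : D j = setT by apply/seteqP; split => // w _ b; rewrite AT.
  split=> //; rewrite [LHS](probability_setT P) big1// => b _.
  by rewrite AT -[RHS](probability_setT P).
rewrite (_ : [set w | _] = [set w | forall j, D j w]); last first.
  apply/seteqP; split => w /= h.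
    by move=> j b; have := h b; rewrite CA; exact.
  by move=> b; rewrite CA => j; exact: h.
rewrite F_indep; last by move=> j; have [] := DP j.
rewrite (eq_bigr (fun j => \prod_b P (A b j))%E); last by move=> j _; have [] := DP j.
rewrite exchange_big/=; apply: eq_bigr => b _; rewrite CA F_indep//.
Qed.

End grouping.

Arguments product_rule {dO Omega R} P {B} C.

(** * Integration over an independent copy *)

Section freezing.
Context {dO} {Omega : measurableType dO} {R : realType} {P : probability Omega R}.
Context {d1 d2} {T1 : measurableType d1} {T2 : measurableType d2}.

(** The joint law is the product law, and Tonelli applies. The inner integral plays the part of the
    conditional expectation given [X]. *)
Lemma integral_indep_pair (X : Omega -> T1) (W : Omega -> T2) (f : T1 * T2 -> \bar R) :
    measurable_fun setT X -> measurable_fun setT W ->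
    (forall A B, measurable A -> measurable B ->
      P (X @^-1` A `&` W @^-1` B) = (P (X @^-1` A) * P (W @^-1` B))%E) ->
    measurable_fun setT f -> (forall z, 0 <= f z)%E ->
  (\int[P]_w f (X w, W w) = \int[P]_w \int[P]_w' f (X w, W w'))%E.
Proof.
move=> mX mW ind mf f0.
pose RX : {RV P >-> T1} := HB.pack X (isMeasurableFun.Build _ _ _ _ _ mX).
pose RW : {RV P >-> T2} := HB.pack W (isMeasurableFun.Build _ _ _ _ _ mW).
have mXW : measurable_fun setT (fun w => (X w, W w)) by exact: measurable_fun_pair.
pose law := measure_function_pushforward__canonical__measure_function_Measure P mXW.
transitivity (\int[law]_z f z)%E.
  by rewrite /law ge0_integral_pushforward.
transitivity (\int[distribution P RX \x distribution P RW]_z f z)%E.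
  apply: eq_measure_integral => A mA _; apply/esym.
  apply: product_measure_unique => //.
rewrite fubini_tonelli1// /fubini_F.
rewrite ge0_integral_pushforward//; last 2 first.
- exact: measurable_fun_fubini_tonelli_F.
- by move=> x _; exact: integral_ge0.
apply: eq_integral => w _ /=; rewrite ge0_integral_pushforward//.
exact: measurable_fun_pair2.
Qed.

End freezing.

(** * The game as a process *)

Lemma measurable_select {dO} {Omega : measurableType dO} {d'} {T : measurableType d'}
    (A : finType) (g : Omega -> A) (phi : A -> Omega -> T) :
    (forall a, measurable [set w | g w = a]) ->
    (forall a, measurable_fun setT (phi a)) ->
  measurable_fun setT (fun w => phi (g w) w).
Proof.
move=> mg mphi _ B mB; rewrite setTI.
rewrite [X in measurable X](_ : _ = [set w | exists a, g w = a /\ B (phi a w)]).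
  apply: measurable_exists_fin => a.
  have mBa : measurable (phi a @^-1` B).
    by rewrite -[X in measurable X]setTI; exact: mphi.
  exact: (measurableI _ _ (mg a) mBa).
by apply/seteqP; split => [w Bw|w [a [<- //]]]; exists (g w).
Qed.

Section sigma_of.
Context {dO dY} {Omega : measurableType dO} {Y : measurableType dY}.
Variable X : Omega -> Y.

Lemma sigma_of_preimage B : measurable B -> sigma_of X (X @^-1` B).
Proof. by move=> mB; exists B => //; rewrite setTI. Qed.

Lemma sigma_of_measurable : measurable_fun setT X -> sigma_of X `<=` measurable.
Proof. by move=> mX _ [B mB <-]; exact: mX. Qed.

Lemma sigma_of_setI : setI_closed (sigma_of X).
Proof.
move=> _ _ [B mB <-] [C mC <-]; rewrite !setTI -preimage_setI.
by apply: sigma_of_preimage; exact: measurableI.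
Qed.

Lemma sigma_of_setT : sigma_of X setT.
Proof. by exists setT => //; rewrite setTI. Qed.

End sigma_of.

Section game.
Context {R : realType} {d T M : nat} {S : {set action d}}.
Hypothesis T_gt0 : (0 < T)%N.
Hypothesis S0 : S != finset.set0.
Context {eta beta : R}.
Context {dO : measure_display} {Omega : measurableType dO} {P : probability Omega R}.
Variable Z : nat -> option 'I_M -> 'I_d -> {RV P >-> R}.
Hypothesis hZexp : forall (t : 'I_T) (k : option 'I_M) (i : 'I_d) (A : set R),
  measurable A -> distribution P (Z t k i) A = exponential_prob 1 A.
Context {dY : measure_display} {Y : measurableType dY}.
Variable U : {RV P >-> Y}.
Variable env : Y -> seq (action d) -> 'I_d -> R.
Hypothesis henv_meas : forall h i, measurable_fun setT (fun y => env y h i).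

Local Notation index := (option ('I_T * option 'I_M * 'I_d)).

Definition source (j : index) : set (set Omega) :=
  match j with
  | Some (t, k, i) => sigma_of (Z t k i)
  | None => sigma_of U
  end.

Hypothesis hindep : mutually_independent P source.

Lemma source_measurable j : source j `<=` measurable.
Proof. by case: j => [[[t k] i]|]; apply: sigma_of_measurable. Qed.

Lemma source_setI j : setI_closed (source j).
Proof. by case: j => [[[t k] i]|]; exact: sigma_of_setI. Qed.

Lemma source_setT j : source j setT.
Proof. by case: j => [[[t k] i]|]; exact: sigma_of_setT. Qed.

Lemma source_indep : product_rule P source.
Proof.
move=> A sA; have := hindep (J := [set: index]%SET) (fun j _ => sA j).
rewrite (eq_bigl xpredT) => [<-|j]; last by rewrite inE.
by congr (P _); apply/seteqP; split => w /= h j; [move=> _|]; apply: h; rewrite /= ?inE.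
Qed.

Local Notation cyl := (cylinders source).

(** What is determined when round [t] starts; the environment's randomness [U] counts as past from
    the outset. *)
Definition before t : pred index :=
  fun j => if j is Some (s, _, _) then (s < t)%N else true.
Definition during t : pred index :=
  fun j => if j is Some (s, _, _) then s == t :> nat else false.
Definition during_sample t k : pred index :=
  fun j => if j is Some (s, k', _) then (s == t :> nat) && (k' == k) else false.

(** The points of [Omega] under a smaller sigma-algebra: adaptedness becomes plain measurability,
    and the identity becomes a random variable to which [integral_indep_pair] applies. *)
Definition sub_algebra (Q : pred index) : Type := g_sigma_algebraType (cyl Q).
HB.instance Definition _ Q := Measurable.on (sub_algebra Q).

Lemma sub_algebra_measurable Q (A : set Omega) :
  measurable (A : set (sub_algebra Q)) -> measurable A.
Proof.
apply: smallest_sub; first exact: sigma_algebra_measurable.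
exact: (cylinders_measurable source_measurable).
Qed.

Lemma measurable_sub_id Q : measurable_fun setT (id : Omega -> sub_algebra Q).
Proof. by move=> _ A mA; rewrite setTI; exact: sub_algebra_measurable mA. Qed.

Lemma sub_algebra_mono (Q Q' : pred index) (A : set Omega) :
    (forall j, Q j -> Q' j) ->
  measurable (A : set (sub_algebra Q)) -> measurable (A : set (sub_algebra Q')).
Proof. by move=> QQ'; apply: sub_sigma_algebra2; exact: cylinders_sub. Qed.

Lemma sub_algebra_fun_mono (Q Q' : pred index) d' (T' : measurableType d') (f : Omega -> T') :
    (forall j, Q j -> Q' j) ->
  measurable_fun setT (f : sub_algebra Q -> T') ->
  measurable_fun setT (f : sub_algebra Q' -> T').
Proof.
by move=> QQ' mf _ B mB; apply: (sub_algebra_mono QQ'); exact: mf.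
Qed.

Lemma sub_algebra_fun Q d' (T' : measurableType d') (f : Omega -> T') :
  measurable_fun setT (f : sub_algebra Q -> T') -> measurable_fun setT f.
Proof. by move=> mf _ B mB; apply: (@sub_algebra_measurable Q); exact: mf. Qed.

Lemma measurable_Z (Q : pred index) (t : 'I_T) k i : Q (Some (t, k, i)) ->
  measurable_fun setT (Z t k i : sub_algebra Q -> R).
Proof.
move=> Qj _ B mB; rewrite setTI; apply: sub_sigma_algebra.
by apply: (cylinders_one source_setT Qj); exact: sigma_of_preimage.
Qed.

Lemma measurable_U (Q : pred index) : Q None ->
  measurable_fun setT (U : sub_algebra Q -> Y).
Proof.
move=> Qj _ B mB; rewrite setTI; apply: sub_sigma_algebra.
by apply: (cylinders_one source_setT Qj); exact: sigma_of_preimage.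
Qed.

Definition perturbation t k (w : Omega) (i : 'I_d) : R := Z t k i w.
Definition state t w := fpl_state S eta beta (env (U w)) (fun t k i => Z t k i w) t.
Definition hist t w := (state t w).1.
Definition est t w := (state t w).2.
Definition loss t w : 'I_d -> R := env (U w) (hist t w).
(** The estimates [L] are a separate argument so that they can be frozen while the sample point
    varies. *)
Definition fpl_samples t (L : 'I_d -> R) w : {ffun option 'I_M -> action d} :=
  [ffun k => fpl_action S eta L (perturbation t k w)].
Definition choices t w := fpl_samples t (est t w) w.

Lemma histS t w : hist t.+1 w = rcons (hist t w) (choices t w None).
Proof.
rewrite /choices /fpl_samples ffunE /hist /est /state/=.
by case: (fpl_state _ _ _ _ _ t).
Qed.

Lemma estS t w i :
  est t.+1 w i = est t w i + round_est beta (loss t w) (choices t w) i.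
Proof.
have -> : round_est beta (loss t w) (choices t w) i = round_est beta (loss t w)
    (fun k => fpl_action S eta (est t w) (perturbation t k w)) i.
  have K : waiting (choices t w) i =
      waiting (fun k => fpl_action S eta (est t w) (perturbation t k w)) i.
    by apply: eq_bigl => k; rewrite ffunE.
  by rewrite /round_est /iw_est K ffunE.
rewrite /est /loss /hist /state/=; case: (fpl_state _ _ _ _ _ t) => h L /=.
by [].
Qed.

Lemma measurable_round_est (Q : pred index) t (a : option 'I_M -> action d) i :
  measurable_fun setT ((fun w => loss t w i) : sub_algebra Q -> R) ->
  measurable_fun setT ((fun w => round_est beta (loss t w) a i) : sub_algebra Q -> R).
Proof.
move=> ml; rewrite /round_est /log_est; apply: measurable_funM => //.
apply: measurableT_comp; first exact: measurable_ln.
apply: measurable_funD => //; apply: measurable_funM => //.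
by rewrite /iw_est; apply: measurable_funM.
Qed.

Lemma measurable_fpl_samples d' (T' : measurableType d') t (L : T' -> 'I_d -> R)
    (pi : T' -> Omega) a :
    (forall i, measurable_fun setT (fun w => L w i)) ->
    (forall k i, measurable_fun setT (fun w => Z t k i (pi w))) ->
  measurable [set w | fpl_samples t (L w) (pi w) = a].
Proof.
move=> mL mZ.
rewrite [X in measurable X](_ : _ =
    [set w | forall k, fpl_action S eta (L w) (perturbation t k (pi w)) = a k]).
  apply: (@measurable_forall_fin _ T' _ (fun k =>
    [set w | fpl_action S eta (L w) (perturbation t k (pi w)) = a k])) => k.
  by apply: measurable_fpl_action => // i; exact: mZ.
apply/seteqP; split => w /= => [<- k|h]; first by rewrite ffunE.
by apply/ffunP => k; rewrite ffunE h.
Qed.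

Lemma before_mono t : forall j : index, before t j -> before t.+1 j.
Proof. by case=> [[[s k] i]|]//=; exact: ltnW. Qed.

(** The three claims are proved jointly: the estimates depend on the losses, and these on the
    history. The sources cover the rounds below [T], hence [t <= T]. *)
Lemma state_measurable t : (t <= T)%N ->
  [/\ forall h, measurable ([set w | hist t w = h] : set (sub_algebra (before t))),
   forall i, measurable_fun setT ((fun w => est t w i) : sub_algebra (before t) -> R) &
   forall i, measurable_fun setT ((fun w => loss t w i) : sub_algebra (before t) -> R)].
Proof.
elim: t => [_|t IHt tT].
  split=> [h|i|i]; rewrite ?/est ?/loss ?/hist/=; last 2 first.
  - exact: measurable_cst.
  - by apply: (measurableT_comp (henv_meas _ _)); exact: measurable_U.
  have [->|h0] := eqVneq h [::].
    by rewrite [X in measurable X](_ : _ = setT)//; apply/seteqP; split.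
  rewrite [X in measurable X](_ : _ = set0)//; apply/seteqP; split => // w /= hh.
  by rewrite -hh eqxx in h0.
have [mh me ml] := IHt (ltnW tT).
have mc a : measurable ([set w | choices t w = a] : set (sub_algebra (before t.+1))).
  apply: (@measurable_fpl_samples _ (sub_algebra (before t.+1)) t (est t) id) => [i|k i].
    by apply: sub_algebra_fun_mono (me i); exact: before_mono.
  by apply: (@measurable_Z (before t.+1) (Ordinal tT)) => /=.
have mh' h : measurable ([set w | hist t.+1 w = h] : set (sub_algebra (before t.+1))).
  case: (lastP h) => [|h' v].
    rewrite [X in measurable X](_ : _ = set0)//; apply/seteqP; split => // w /=.
    by rewrite histS => /(congr1 size); rewrite size_rcons.
  rewrite [X in measurable X](_ : _ = [set w | hist t w = h'] `&`
      [set w | exists a, choices t w = a /\ a None = v]).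
    apply: measurableI.
      by apply: sub_algebra_mono (mh h'); exact: before_mono.
    apply: (@measurable_exists_fin _ (sub_algebra (before t.+1)) _
      (fun a => [set w | choices t w = a /\ a None = v])) => a.
    have [av|av] := eqVneq (a None) v.
      rewrite [X in measurable X](_ : _ = [set w | choices t w = a])//.
      by apply/seteqP; split => w /= => [[]|].
    rewrite [X in measurable X](_ : _ = set0)//; apply/seteqP; split => // w /= [_ ?].
    by move/eqP: av.
  apply/seteqP; split => w /=; rewrite histS.
    by move=> /rcons_inj[-> <-]; split => //; exists (choices t w).
  by move=> [-> [a [-> ->]]].
have me' i : measurable_fun setT ((fun w => est t.+1 w i) : sub_algebra (before t.+1) -> R).
  rewrite (_ : (fun w => _) = (fun w => est t w i + round_est beta (loss t w) (choices t w) i)).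
    apply: measurable_funD.
      by apply: sub_algebra_fun_mono (me i); exact: before_mono.
    apply: (@measurable_select _ (sub_algebra (before t.+1)) _ _ _ (choices t)
      (fun a w => round_est beta (loss t w) a i)) => // a.
    apply: measurable_round_est; apply: sub_algebra_fun_mono (ml i).
    exact: before_mono.
  by apply/funext => w; rewrite estS.
split=> // i _ B mB; rewrite setTI.
(* The loss evaluates [env] at a random history; histories are countably many, and for each of them
   the loss is measurable in [U]. *)
rewrite [X in measurable X](_ : _ = \bigcup_(h : seq (action d))
   ([set w | hist t.+1 w = h] `&` [set w | B (env (U w) h i)])).
  apply: countable_bigcupT_measurable; first exact: countableP.
  move=> h; apply: measurableI => //.
  have mU := @measurable_U (before t.+1) isT.
  by rewrite -[X in measurable X]setTI; exact: (measurableT_comp (henv_meas h i) mU).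
apply/seteqP; split => w /=; first by exists (hist t.+1 w).
by move=> [h _ /= [<-]].
Qed.

Lemma est_measurable t i : (t <= T)%N ->
  measurable_fun setT ((fun w => est t w i) : sub_algebra (before t) -> R).
Proof. by case/state_measurable. Qed.

Lemma loss_measurable t i : (t <= T)%N ->
  measurable_fun setT ((fun w => loss t w i) : sub_algebra (before t) -> R).
Proof. by case/state_measurable. Qed.

Lemma choices_measurable t a : (t < T)%N ->
  measurable ([set w | choices t w = a] : set (sub_algebra (before t.+1))).
Proof.
move=> tT.
apply: (@measurable_fpl_samples _ (sub_algebra (before t.+1)) t (est t) id) => [i|k i].
  by apply: sub_algebra_fun_mono (est_measurable i (ltnW tT)); exact: before_mono.
by apply: (@measurable_Z (before t.+1) (Ordinal tT)) => /=.
Qed.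

Lemma perturbation_iid t k : (t < T)%N -> iid_exponential P (perturbation t k).
Proof.
move=> tT A mA; pose Q (i : 'I_d) : pred index := pred1 (Some (Ordinal tT, k, i)).
have ind : product_rule P (fun i => <<s cyl (Q i) >>).
  apply: (cylinders_indep source_measurable source_setI source_setT source_indep).
  by move=> i i' j /eqP-> /eqP[].
rewrite (ind (fun i => Z t k i @^-1` A i)) => [|i].
  by apply: eq_bigr => i _; exact: (hZexp (Ordinal tT)).
apply: sub_sigma_algebra.
apply: (cylinders_one source_setT (j := Some (Ordinal tT, k, i))).
  by rewrite /Q /= eqxx.
exact: sigma_of_preimage.
Qed.

(* All the [Z t k] with [t < T] have the same law, so the conditional law of the
   actions of any round can be computed with [Z 0 None]. *)
Definition prob := @play_prob R d S eta dO Omega P (perturbation 0 None).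

Lemma prob_of t k L u : (t < T)%N ->
  P [set w | fpl_action S eta L (perturbation t k w) = u] = (prob L u)%:E.
Proof.
move=> tT; rewrite /prob /play_prob fineK; last first.
  by rewrite fin_num_measure//; apply: (@measurable_fpl_action _ _ _ _ _ _ (fun=> L)).
apply: (@same_law _ _ _ _ P _ _ _ _ _ P _ [set x : vectors | fpl_action S eta L x = u]) => //.
- exact: perturbation_iid.
- exact: perturbation_iid.
- exact: measurable_fpl_vectors.
Qed.

Lemma fpl_samples_law t L a : (t < T)%N ->
  P [set w | fpl_samples t L w = a] = (prod_mass (prob L) a)%:E.
Proof.
move=> tT.
have ind : product_rule P (fun k => <<s cyl (during_sample t k) >>).
  apply: (cylinders_indep source_measurable source_setI source_setT source_indep).
  by move=> k k' [[[s k1] i]|]//= /andP[_ /eqP <-] /andP[_ /eqP].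
have -> : [set w | fpl_samples t L w = a] =
    [set w | forall k, [set w | fpl_action S eta L (perturbation t k w) = a k] w].
  apply/seteqP; split => w /= => [<- k|h]; first by rewrite ffunE.
  by apply/ffunP => k; rewrite ffunE h.
rewrite ind => [|k].
  by rewrite /prod_mass -prodEFin; apply: eq_bigr => k _; exact: prob_of.
apply: (@measurable_fpl_action _ _ _ _ _ (sub_algebra (during_sample t k)) (fun=> L)) => // i.
by apply: (@measurable_Z _ (Ordinal tT)); rewrite /= !eqxx.
Qed.

Lemma before_during_indep t A B : 
  measurable (A : set (sub_algebra (before t))) ->
  measurable (B : set (sub_algebra (during t))) ->
  P (A `&` B) = (P A * P B)%E.
Proof.
move=> mA mB; pose Q b : pred index := if b then before t else during t.
have ind : product_rule P (fun b => <<s cyl (Q b) >>).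
  apply: (cylinders_indep source_measurable source_setI source_setT source_indep).
  have excl (j : index) : before t j -> during t j -> False.
    by case: j => [[[s k] i]|]//= st /eqP se; rewrite se ltnn in st.
  by move=> [] [] j //= h1 h2; [case: (excl j h1 h2)|case: (excl j h2 h1)].
have := ind (fun b => if b then A else B).
rewrite big_bool/= => <-; last by case.
congr (P _); apply/seteqP; split => w /= => [[Aw Bw] []//|h].
by split; [exact: (h true)|exact: (h false)].
Qed.

(** The probability is the measure of a section of a measurable set in a product space. *)
Lemma prob_measurable t u : (t <= T)%N ->
  measurable_fun setT ((fun w => prob (est t w) u) : sub_algebra (before t) -> R).
Proof.
move=> tT; pose E := [set z : sub_algebra (before t) * Omega |
  fpl_action S eta (est t z.1) (perturbation 0 None z.2) = u].
have mE : measurable E.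
  apply: (@measurable_fpl_action _ _ _ _ _ _
    (fun z : sub_algebra (before t) * Omega => est t z.1)
    (fun z => perturbation 0 None z.2)) => i.
    exact: (measurableT_comp (est_measurable i tT) measurable_fst).
  have mZ : measurable_fun setT (Z 0 None i) by [].
  exact: (measurableT_comp mZ measurable_snd).
rewrite (_ : (fun w => _) = fine \o (P \o xsection E)).
  by apply: measurableT_comp; [exact: fine_measurable|exact: measurable_fun_xsection].
apply/funext => w; rewrite /prob /play_prob/=; congr (fine (P _)).
by apply/seteqP; split => w' /=; rewrite /xsection/= inE.
Qed.

Lemma process_measurable (xi : nat -> Omega -> {ffun option 'I_M -> action d} -> R) n :
    (forall t a, (t < T)%N ->
      measurable_fun setT (xi t ^~ a : sub_algebra (before t) -> R)) ->
    (n <= T)%N ->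
  measurable_fun setT ((fun w => \sum_(t < n) xi t w (choices t w)) :
    sub_algebra (before n) -> R).
Proof.
move=> mxi nT; apply: measurable_sum => t.
have tT : (t < T)%N by exact: leq_trans (ltn_ord t) nT.
have before_le s : (s <= n)%N -> forall j : index, before s j -> before n j.
  by move=> sn [[[r k] i]|]//= rs; exact: leq_trans sn.
apply: (@measurable_select _ (sub_algebra (before n)) _ _ _ (choices t)
  (fun a w => xi t w a)) => a.
  apply: sub_algebra_mono (choices_measurable a tT).
  by apply: before_le; exact: ltn_ord.
by apply: sub_algebra_fun_mono (mxi t a tT); apply: before_le; exact: ltnW.
Qed.

(** The supermartingale bound. Since [xi t w a] sees [w] only through the past, the last round can
    be integrated over an independent copy and contributes a factor at most 1. *)
Lemma exp_process_le1 (xi : nat -> Omega -> {ffun option 'I_M -> action d} -> R) n :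
    (forall t a, (t < T)%N ->
      measurable_fun setT (xi t ^~ a : sub_algebra (before t) -> R)) ->
    (forall t w, (t < T)%N -> prod_exp (prob (est t w)) (fun a => expR (xi t w a)) <= 1) ->
    (n <= T)%N ->
  (\int[P]_w (expR (\sum_(t < n) xi t w (choices t w)))%:E <= 1)%E.
Proof.
move=> mxi xi1.
elim: n => [_|n IHn nT].
  under eq_integral do rewrite big_ord0 expR0.
  by rewrite integral_cst// mul1e [X in (X <= _)%E](probability_setT P).
pose D w := expR (\sum_(t < n) xi t w (choices t w)).
have mD : measurable_fun setT (D : sub_algebra (before n) -> R).
  apply: measurableT_comp; first exact: measurable_expR.
  exact: (process_measurable mxi (ltnW nT)).
(* The first component carries the past, the second the randomness of round [n]; the integrand is
   [f] on the diagonal. *)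
pose f (z : sub_algebra (before n) * sub_algebra (during n)) : \bar R :=
  (D z.1 * expR (xi n z.1 (fpl_samples n (est n z.1) z.2)))%:E.
have mf : measurable_fun setT f.
  apply/measurable_EFinP; apply: measurable_funM.
    exact: (measurableT_comp mD measurable_fst).
  apply: measurableT_comp; first exact: measurable_expR.
  apply: (@measurable_select _ _ _ _ _
    (fun z : sub_algebra (before n) * sub_algebra (during n) => fpl_samples n (est n z.1) z.2)
    (fun a z => xi n z.1 a)) => a.
    apply: (@measurable_fpl_samples _ _ n
      (fun z : sub_algebra (before n) * sub_algebra (during n) => est n z.1) snd) => [i|k i].
      exact: (measurableT_comp (est_measurable i (ltnW nT)) measurable_fst).
    have mZ : measurable_fun setT (Z n k i : sub_algebra (during n) -> R).
      by apply: (@measurable_Z _ (Ordinal nT)); rewrite /= eqxx.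
    exact: (measurableT_comp mZ measurable_snd).
  exact: (measurableT_comp (mxi n a nT) measurable_fst).
have f0 z : (0 <= f z)%E by rewrite lee_fin mulr_ge0 ?expR_ge0.
rewrite (_ : (\int[P]_w _) = \int[P]_w f (w, w))%E; last first.
  by apply: eq_integral => w _; rewrite /f/= /D -expRD big_ord_recr.
rewrite (@integral_indep_pair _ _ _ P _ _ (sub_algebra (before n)) (sub_algebra (during n))
  id id f (@measurable_sub_id _) (@measurable_sub_id _))//; last first.
  exact: before_during_indep.
apply: le_trans (IHn (ltnW nT)).
have mD' : measurable_fun setT (fun w : Omega => (D w)%:E).
  apply/measurable_EFinP.
  exact: (sub_algebra_fun mD).
have inner w : (\int[P]_w' f (w, w') =
    (D w * prod_exp (prob (est n w)) (fun a => expR (xi n w a)))%:E)%E.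
  rewrite /f/= (@integral_fin_valued _ _ _ P _ (fpl_samples n (est n w))
    (fun a => D w * expR (xi n w a))) => [|a|a].
  - congr (_%:E); rewrite /prod_exp mulr_sumr; apply: eq_bigr => a _.
    by rewrite fpl_samples_law//=; ring.
  - exact: (@measurable_fpl_samples _ _ n (fun=> est n w) id).
  - by rewrite mulr_ge0 ?expR_ge0.
apply: ge0_le_integral => //.
- by move=> w _; exact: integral_ge0.
- under eq_fun do rewrite inner.
  apply/measurable_EFinP.
  suff mF : measurable_fun setT ((fun w => D w * prod_exp (prob (est n w))
      (fun a => expR (xi n w a))) : sub_algebra (before n) -> R).
    exact: (sub_algebra_fun mF).
  apply: measurable_funM => //; apply: measurable_sum => a.
  apply: measurable_funM.
    by apply: measurable_prod => k _; apply: prob_measurable; exact: ltnW.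
  by apply: measurableT_comp; [exact: measurable_expR|exact: mxi].
move=> w _; rewrite inner lee_fin -[leRHS]mulr1 ler_wpM2l ?expR_ge0//.
exact: xi1.
Qed.

End game.

(** * The regret bound *)

Section deviation.
Context {dO} {Omega : measurableType dO} {R : realType} {P : probability Omega R}.

Lemma exp_tail_le (Y : Omega -> R) (c : R) : measurable_fun setT Y ->
    (\int[P]_w (expR (Y w))%:E <= 1)%E ->
  (P [set w | (c <= Y w)%R] <= (expR (- c))%:E)%E.
Proof.
move=> mY EY.
have mA : measurable [set w | c <= Y w].
  by apply: measurable_setb; exact: measurable_fun_ler.
rewrite expRN -[X in (_ <= X%:E)%E]div1r EFinM lee_pdivlMr ?expR_gt0//.
have -> : P [set w | (c <= Y w)%R] = (\int[P]_w (\1_[set w | (c <= Y w)%R] w)%:E)%E.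
  by rewrite integral_indic// setIT.
apply: le_trans EY; rewrite muleC.
rewrite -ge0_integralZl//; last first.
  by apply/measurable_EFinP; exact: measurable_indic.
apply: ge0_le_integral => //.
- by apply: measurable_funeM; apply/measurable_EFinP; exact: measurable_indic.
- by apply/measurable_EFinP; apply: measurableT_comp => //; exact: measurable_expR.
move=> w _; rewrite -EFinM lee_fin indicE; have [/set_mem/= cY|_] := boolP (w \in _).
  by rewrite mulr1 ler_expR.
by rewrite mulr0 expR_ge0.
Qed.

Lemma probability_exists_le (I : finType) (E : I -> set Omega) :
  (forall i, measurable (E i)) ->
  (P [set w | exists i, E i w] <= \sum_i P (E i))%E.
Proof.
move=> mE.
have -> : [set w | exists i, E i w] = \big[setU/set0]_i E i.
  apply/seteqP; split => [w [i Eiw]|w].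
    by rewrite -bigcup_seq; exists i => //=; rewrite mem_index_enum.
  by rewrite -bigcup_seq => -[i _ Eiw]; exists i.
elim: (index_enum I) => [|i s IHs]; first by rewrite !big_nil measure0.
rewrite !big_cons; apply: le_trans (leeD2l _ IHs).
by apply: measureU2 => //; exact: bigsetU_measurable.
Qed.

End deviation.

Section regret_bound.
Context {R : realType} {m d T M : nat} {S : {set action d}}.
Hypothesis m_gt0 : (0 < m)%N.
Hypothesis m_le_d : (m <= d)%N.
Hypothesis T_gt0 : (0 < T)%N.
Hypothesis S0 : S != finset.set0.
Hypothesis Sm : forall v : action d, v \in S -> (\sum_(i < d) v i <= m)%N.
Variable delta : R.
Hypothesis delta_gt0 : 0 < delta.
Hypothesis delta_lt1 : delta < 1.
Context {eta beta : R}.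
Hypothesis eta_gt0 : 0 < eta.
Hypothesis beta_gt0 : 0 < beta.
Hypothesis M_gt0 : (0 < M)%N.
Context {dO : measure_display} {Omega : measurableType dO} {P : probability Omega R}.
Variable Z : nat -> option 'I_M -> 'I_d -> {RV P >-> R}.
Hypothesis hZexp : forall (t : 'I_T) (k : option 'I_M) (i : 'I_d) (A : set R),
  measurable A -> distribution P (Z t k i) A = exponential_prob 1 A.
Context {dY : measure_display} {Y : measurableType dY}.
Variable U : {RV P >-> Y}.
Variable env : Y -> seq (action d) -> 'I_d -> R.
Hypothesis henv_meas : forall h i, measurable_fun setT (fun y => env y h i).
Hypothesis henv01 : forall y h i, 0 <= env y h i <= 1.
Hypothesis hindep : mutually_independent P (@source _ _ T M _ _ P Z _ _ U).

Local Notation est := (@est R d M S eta beta dO Omega P Z dY Y U env).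
Local Notation loss := (@loss R d M S eta beta dO Omega P Z dY Y U env).
Local Notation choices := (@choices R d M S eta beta dO Omega P Z dY Y U env).
Local Notation prob := (@prob R d M S eta dO Omega P Z).
Local Notation round_drift := (@drift R d M m eta beta).
Local Notation excess t w a := (round_excess (prob (est t w)) eta beta (loss t w) a).

Local Notation history t := (@sub_algebra R d T M dO Omega P Z dY Y U (@before d T M t)).

Definition regret_of v w : R := regret_against S eta beta (env (U w)) (fun t k i => Z t k i w) T v.

Definition total_regret w : R := regret S eta beta (env (U w)) (fun t k i => Z t k i w) T.

Lemma prob_round (t : 'I_T) w : [/\ forall u, 0 <= prob (est t w) u,
  \sum_u prob (est t w) u = 1 &
  forall u, prob (est t w) u != 0 -> (\sum_(i < d) u i <= m)%N].
Proof.
have mX (i : 'I_d) : measurable_fun setT (fun w => perturbation Z 0 None w i) by [].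
split=> [u||u pu]; first exact: play_prob_ge0.
  exact: play_prob_sum1.
exact/Sm/(play_prob_supp S0 pu).
Qed.

Lemma regret_of_eq v w : regret_of v w =
  \sum_(t < T) excess t w (choices t w)
  + \sum_(t < T) discounted_loss (prob (est t w)) eta (round_est beta (loss t w) (choices t w))
  - \sum_(t < T) dotp v (loss t w).
Proof.
rewrite -big_split/= -sumrB; apply: eq_bigr => t _.
rewrite /round_excess subrK /dotp -sumrB; apply: eq_bigr => i _.
by rewrite mulrBl /choices /fpl_samples ffunE.
Qed.

Lemma total_regret_le w c : (forall v, v \in S -> regret_of v w <= c) -> total_regret w <= c.
Proof.
move=> h; rewrite /total_regret /regret; apply: bigmax_le => [|v vS].
  exact/h/some_action_in.
exact: h.
Qed.

Lemma total_regret_le_trivial w : total_regret w <= m%:R * T%:R.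
Proof.
apply: total_regret_le => v vS; rewrite /regret_of /regret_against.
rewrite mulrC mulr_natl -[X in _ *+ X](card_ord T) -sumr_const; apply: ler_sum => t _.
set V := played_action _ _ _ _ _ _.
have VS : V \in S by have [] := argminP S0 (fun i => eta * est t w i - Z t None i w).
apply: (@le_trans _ _ (dotp V (loss t w))).
  apply: ler_sum => i _; have /andP[l0 _] : 0 <= loss t w i <= 1 by exact: henv01.
  by rewrite mulrBl gerBl mulr_ge0.
rewrite -[leRHS]mulr1 dotp_le_cst// ?Sm// => i.
by have /andP[] : 0 <= loss t w i <= 1 by exact: henv01.
Qed.

Lemma measurable_total_regret : measurable_fun setT total_regret.
Proof.
have mreg v : measurable_fun setT (regret_of v).
  rewrite (_ : regret_of v = fun w => \sum_(t < T) \sum_(i < d)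
     ((choices t w None i)%:R - (v i)%:R) * loss t w i); last first.
    apply/funext => w; apply: eq_bigr => t _; apply: eq_bigr => i _.
    by rewrite /choices /fpl_samples ffunE.
  apply: measurable_sum => t; apply: measurable_sum => i.
  apply: measurable_funM.
    apply: measurable_funB => //.
    apply: (@measurable_fin_comp _ _ _ _ _ (choices t) (fun a => (a None i)%:R : R)) => a.
    apply: (@measurable_fpl_samples _ _ _ _ _ _ _ _ Z _ _ t (est t) id) => // j.
    have me := est_measurable (S := S) (eta := eta) (beta := beta)
      (Z := Z) (U := U) henv_meas j (ltnW (ltn_ord t)).
    exact: (sub_algebra_fun me).
  have ml := loss_measurable (S := S) (eta := eta) (beta := beta)
    (Z := Z) (U := U) henv_meas i (ltnW (ltn_ord t)).
  exact: (sub_algebra_fun ml).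
rewrite /total_regret /regret.
have : forall s : seq (action d), measurable_fun setT (fun w =>
    \big[Num.max/regret_of (some_action S) w]_(v <- s | v \in S) regret_of v w).
  elim=> [|v s IHs]; first by (under eq_fun do rewrite big_nil); exact: mreg.
  have [vS|vS] := boolP (v \in S).
    under eq_fun do rewrite big_cons vS.
    by apply: measurable_maxr; first exact: mreg.
  by under eq_fun do rewrite big_cons (negbTE vS).
exact.
Qed.

Local Notation scale := (Num.sqrt (2 * (expR 1 - 2) * T%:R) : R).
(* The tilt for which the linear term of the exponential bound is exactly
   [m * scale * ln (5 / delta)]. *)
Let lam : R := (m%:R * scale)^-1.

Lemma sqr_scale : scale ^+ 2 = 2 * (expR 1 - 2) * T%:R.
Proof.
have e1 := @expR1_ge R; apply: sqr_sqrtr.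
by apply: mulr_ge0; [lra|exact: ler0n].
Qed.

Lemma scale_gt0 : 0 < scale.
Proof.
have e1 := @expR1_ge R; rewrite sqrtr_gt0.
by apply: mulr_gt0; [lra|rewrite ltr0n].
Qed.

(** The number [689 / 500] lies between [1.95 / (2 (e - 2))] and [ln 4], which are close. *)
Lemma ln4_ge : 689 / 500 <= ln 4 :> R.
Proof.
have x1 : 283 / 400 <= expR (- (689 / 2000)) :> R.
  by apply: le_trans _ (expR_ge_taylor3 _); lra.
have x2 : 1 / 2 <= expR (- (689 / 2000)) ^+ 2 :> R.
  by apply: le_trans (ler_pM _ _ x1 x1); lra.
have x4 : 1 / 4 <= (expR (- (689 / 2000)) ^+ 2) ^+ 2 :> R.
  by apply: le_trans (ler_pM _ _ x2 x2); lra.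
rewrite -(expRK (689 / 500 : R)) ler_ln ?posrE ?expR_gt0//.
have e4 : expR (689 / 500) * (expR (- (689 / 2000)) ^+ 2) ^+ 2 = 1 :> R.
  by rewrite -exprM -expRM_natl -expRD -[RHS]expR0; congr expR; field.
have e0 := expR_gt0 (689 / 500 : R).
by have := ler_wpM2l (ltW e0) x4; lra.
Qed.

(** From [e ^ 3 <= 25] and [delta < 1]. *)
Lemma ln5_delta : 3 / 2 <= ln (5 / delta).
Proof.
rewrite -(expRK (3 / 2 : R)) ler_ln ?posrE ?expR_gt0 ?divr_gt0//.
have e0 := expR_gt0 (3 / 2 : R).
have sq : expR (3 / 2) * expR (3 / 2) = expR 1 * expR 1 * expR 1 :> R.
  by rewrite -!expRD; congr expR; field.
have cube : expR 1 * expR 1 * expR 1 <= 25 :> R.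
  have e1 := @expR1_le R; have e2 := @expR_ge0 R 1.
  have sq1 := ler_pM e2 e2 e1 e1.
  have sq2 := ler_pM (mulr_ge0 e2 e2) e2 sq1 e1.
  by apply: le_trans sq2 _; lra.
apply: (@le_trans _ _ 5); first by nra.
rewrite ler_pdivlMr//; have := ltW delta_lt1; lra.
Qed.

Lemma drift_ge0 : 0 <= round_drift.
Proof.
rewrite /drift !addr_ge0// ?divr_ge0 ?mulr_ge0 ?expR_ge0 ?(ltW beta_gt0) ?(ltW eta_gt0)//.
Qed.

Definition sharp_bound : R := m%:R * (ln (d%:R / m%:R) + 1) / eta + T%:R * round_drift
  + m%:R * ln (5 * d%:R / delta) / beta + m%:R * scale * ln (5 / delta).

Lemma d_gt0 : (0 < d)%N. Proof. exact: leq_trans m_le_d. Qed.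

Lemma ln_d_m_ge0 : 0 <= ln (d%:R / m%:R) :> R.
Proof. by rewrite ln_ge0// ler_pdivlMr ?ltr0n// mul1r ler_nat. Qed.

Lemma ln_5d_delta_ge0 : 0 <= ln (5 * d%:R / delta).
Proof.
rewrite ln_ge0// ler_pdivlMr// mul1r; apply: (le_trans (ltW delta_lt1)).
have : 1 <= d%:R :> R by rewrite ler1n d_gt0.
lra.
Qed.

(** The deviation term alone suffices, as [T ^ 2 <= 2 T <= (3 / 2 * scale) ^ 2]. *)
Lemma sharp_bound_short : (T <= 2)%N -> m%:R * T%:R <= sharp_bound.
Proof.
move=> T2.
have h1 : 0 <= m%:R * (ln (d%:R / m%:R) + 1) / eta.
  by rewrite divr_ge0 ?(ltW eta_gt0)// mulr_ge0// addr_ge0// ln_d_m_ge0.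
have h2 : 0 <= T%:R * round_drift by rewrite mulr_ge0// drift_ge0.
have h3 : 0 <= m%:R * ln (5 * d%:R / delta) / beta.
  by rewrite divr_ge0 ?(ltW beta_gt0)// mulr_ge0// ln_5d_delta_ge0.
suff : m%:R * T%:R <= m%:R * scale * ln (5 / delta) by rewrite /sharp_bound; lra.
rewrite -mulrA ler_wpM2l//.
have s0 := scale_gt0; have sq := sqr_scale; have e1 := @expR1_ge R.
have l5 := ln5_delta.
have t2 : T%:R <= 2 :> R by rewrite ler_nat.
have t1 : 1 <= T%:R :> R by rewrite ler1n.
apply: (@le_trans _ _ (scale * (3 / 2))); last by rewrite ler_wpM2l// ltW.
have s32 : 0 <= scale * (3 / 2) by apply: mulr_ge0; [exact: ltW|lra].
rewrite -(@ler_pXn2r _ 2) ?nnegrE// exprMn sq.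
have q1 : T%:R * T%:R <= T%:R * 2 :> R by rewrite ler_wpM2l.
have q2 : 0 <= (expR 1 - 677 / 250) * T%:R :> R by apply: mulr_ge0; lra.
lra.
Qed.

Definition est_gap i t w (a : {ffun option 'I_M -> action d}) : R :=
  beta * (round_est beta (loss t w) a i - loss t w i).

(** Normalized so that its exponential has conditional mean at most 1. *)
Definition tilted_excess t w (a : {ffun option 'I_M -> action d}) : R :=
  lam * excess t w a - (lam * round_drift + 195 / 100 * (lam * m%:R) ^+ 2).

Lemma est_gap_measurable i t a : (t < T)%N ->
  measurable_fun setT ((fun w => est_gap i t w a) : history t -> R).
Proof.
move=> tT; have ml := loss_measurable (S := S) (eta := eta) (beta := beta)
  (Z := Z) (U := U) henv_meas i (ltnW tT).
apply: measurable_funM => //; apply: measurable_funB => //.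
exact: measurable_round_est.
Qed.

Lemma tilted_excess_measurable t a : (t < T)%N ->
  measurable_fun setT ((fun w => tilted_excess t w a) : history t -> R).
Proof.
move=> tT; have ml i := loss_measurable (S := S) (eta := eta) (beta := beta)
  (Z := Z) (U := U) henv_meas i (ltnW tT).
have mp u := prob_measurable (S := S) (eta := eta) (beta := beta)
  (Z := Z) (U := U) henv_meas u (ltnW tT).
apply: measurable_funB => //; apply: measurable_funM => //.
apply: measurable_funB.
  by apply: measurable_sum => i; apply: measurable_funM.
have md u : measurable_fun setT ((fun w => dotp u (round_est beta (loss t w) a)) :
    history t -> R).
  by apply: measurable_sum => i; apply: measurable_funM => //; exact: measurable_round_est.
apply: measurable_sum => u; apply: measurable_funM => //; apply: measurable_funM => //.
apply: measurableT_comp; first exact: measurable_expR.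
by apply: measurable_funN; exact: measurable_funM.
Qed.

Lemma est_gap_tail i :
  (P [set w | (ln (5 * d%:R / delta) <= \sum_(t < T) est_gap i t w (choices t w))%R]
    <= (delta / (5 * d%:R))%:E)%E.
Proof.
have mxi t a : (t < T)%N -> _ := @est_gap_measurable i t a.
have -> : delta / (5 * d%:R) = expR (- ln (5 * d%:R / delta)).
  rewrite expRN lnK ?invf_div// posrE divr_gt0// mulr_gt0// ltr0n d_gt0//.
apply: exp_tail_le.
  exact: (sub_algebra_fun (process_measurable henv_meas mxi (leqnn T))).
apply: (exp_process_le1 T_gt0 hZexp henv_meas hindep (xi := est_gap i)) => // t w tT.
have [p0 p1 _] := prob_round (Ordinal tT) w.
apply: exp_log_est_le1 => // j; exact: henv01.
Qed.

Lemma tilted_excess_tail : (2 < T)%N ->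
  (P [set w | (ln (5 / (4 * delta)) <= \sum_(t < T) tilted_excess t w (choices t w))%R]
    <= (4 * delta / 5)%:E)%E.
Proof.
move=> T2; have mxi t a : (t < T)%N -> _ := @tilted_excess_measurable t a.
have -> : 4 * delta / 5 = expR (- ln (5 / (4 * delta))).
  rewrite expRN lnK ?invf_div// posrE divr_gt0// mulr_gt0//.
apply: exp_tail_le.
  exact: (sub_algebra_fun (process_measurable henv_meas mxi (leqnn T))).
apply: (exp_process_le1 T_gt0 hZexp henv_meas hindep (xi := tilted_excess)) => // t w tT.
have [p0 p1 pm] := prob_round (Ordinal tT) w.
have s0 := scale_gt0.
have lam0 : 0 <= lam by rewrite invr_ge0 mulr_ge0// ltW.
have lamm : lam * m%:R = scale^-1.
  by rewrite /lam invfM mulrAC mulVf ?mul1r// pnatr_eq0 -lt0n.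
(* The assumption [T >= 3] enters here, through [scale >= 100 / 49]. *)
have lam49 : lam * m%:R <= 49 / 100.
  rewrite lamm -[leLHS]div1r ler_pdivrMr//.
  have sq := sqr_scale; have e1 := @expR1_ge R.
  have t3 : 3 <= T%:R :> R by rewrite ler_nat.
  have q2 : 0 <= (expR 1 - 677 / 250) * T%:R :> R by apply: mulr_ge0; lra.
  have : 100 / 49 <= scale.
    rewrite -(@ler_pXn2r _ 2) ?nnegrE; [|by []|by lra|exact: ltW].
    by rewrite sq; lra.
  by lra.
have l01 j : 0 <= loss t w j <= 1 by exact: henv01.
have key := @exp_expR_round_excess_le R d M m (prob (est t w)) eta beta (loss t w)
  p0 p1 pm eta_gt0 beta_gt0 l01 M_gt0 lam lam0 lam49.
rewrite /tilted_excess.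
rewrite (@eq_prod_exp _ _ _ _ _ (fun a =>
    expR (- (lam * round_drift + 195 / 100 * (lam * m%:R) ^+ 2)) *
    expR (lam * excess t w a))).
  rewrite prod_expZ expRN mulrC ler_pdivrMr ?expR_gt0//.
  by rewrite mul1r.
by move=> a; rewrite -expRD addrC.
Qed.

Lemma total_regret_le_sharp w : (2 < T)%N ->
    (forall i, \sum_(t < T) est_gap i t w (choices t w) < ln (5 * d%:R / delta)) ->
    \sum_(t < T) tilted_excess t w (choices t w) < ln (5 / (4 * delta)) ->
  total_regret w <= sharp_bound.
Proof.
move=> T2 gap exc; apply: total_regret_le => v vS; rewrite regret_of_eq.
have s0 := scale_gt0.
have ms0 : 0 < m%:R * scale by rewrite mulr_gt0 ?ltr0n.
pose l_ t := round_est beta (loss t w) (choices t w).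
(* The estimates are those of the fixed [w], while the perturbation [Z 0 None] is integrated over a
   sample point of its own. *)
have fpl : \sum_(t < T) discounted_loss (prob (est t w)) eta (l_ t)
    <= dotp v (est T w) + m%:R * (ln (d%:R / m%:R) + 1) / eta.
  have iid := perturbation_iid hZexp hindep None T_gt0.
  have mX (i : 'I_d) : measurable_fun setT (fun w => perturbation Z 0 None w i) by [].
  have estS' t i : est t.+1 w i = est t w i + l_ t i by rewrite estS.
  have l0 t i : 0 <= l_ t i by apply: round_est_ge0 => // j; exact: henv01.
  have est0' i : est 0 w i = 0 by [].
  exact: (@fpl_regret _ _ _ _ _ _ _ _ S0 eta_gt0 mX iid m m_gt0 m_le_d Sm
    (fun t => est t w) l_ T v vS est0' estS' l0).
have estE n i : est n w i = \sum_(t < n) l_ t i.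
  elim: n => [|n IHn]; first by rewrite big_ord0.
  by rewrite big_ord_recr/= estS IHn.
(* Control of each coordinate serves all [v] at once, so the union bound runs over [d] coordinates
   and not over [S]. *)
have gaps : dotp v (est T w) - \sum_(t < T) dotp v (loss t w)
    <= m%:R * (ln (5 * d%:R / delta) / beta).
  have -> : dotp v (est T w) - \sum_(t < T) dotp v (loss t w) =
      dotp v (fun i => \sum_(t < T) (l_ t i - loss t w i)).
    rewrite /dotp exchange_big/= -sumrB; apply: eq_bigr => i _.
    have -> : \sum_(t < T) (v i)%:R * loss t w i = (v i)%:R * \sum_(t < T) loss t w i.
      by rewrite mulr_sumr.
    by rewrite [X in _ = _ * X]sumrB mulrBr estE.
  apply: dotp_le_cst; first exact: Sm.
    by rewrite divr_ge0 ?(ltW beta_gt0)// ln_5d_delta_ge0.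
  move=> i; rewrite ler_pdivlMr// mulrC mulr_sumr.
  by apply: le_trans (ltW (gap i)).
have total : \sum_(t < T) excess t w (choices t w)
    <= T%:R * round_drift + m%:R * scale * ln (5 / delta).
  have lamS : lam * (m%:R * scale) = 1 by rewrite mulVf// gt_eqF.
  have sumE : \sum_(t < T) tilted_excess t w (choices t w) =
      lam * (\sum_(t < T) excess t w (choices t w))
      - T%:R * (lam * round_drift + 195 / 100 * (lam * m%:R) ^+ 2).
    by rewrite sumrB mulr_sumr sumr_const card_ord [in RHS]mulr_natl.
  (* The quadratic term is 195/200 / (e - 2) <= ln 4: it turns the budget
     [ln (5 / (4 delta))] into [ln (5 / delta)]. *)
  have quad : T%:R * (195 / 100 * (lam * m%:R) ^+ 2) <= ln 4.
    have -> : lam * m%:R = scale^-1.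
      by rewrite /lam invfM mulrAC mulVf ?mul1r// pnatr_eq0 -lt0n.
    apply: le_trans ln4_ge; rewrite exprVn sqr_scale.
    have e1 := @expR1_ge R; have T0 : 0 < T%:R :> R by rewrite ltr0n.
    rewrite mulrA ler_pdivrMr; last by apply: mulr_gt0 => //; lra.
    have : 0 <= (expR 1 - 677 / 250) * T%:R :> R by apply: mulr_ge0; lra.
    by lra.
  have ln4 : ln (5 / (4 * delta)) + ln 4 = ln (5 / delta).
    rewrite -lnM ?posrE ?divr_gt0 ?mulr_gt0//; congr ln.
    by field; rewrite gt_eqF.
  have lam0 : 0 < lam by rewrite invr_gt0.
  rewrite -(ler_pM2l lam0) mulrDr [lam * (_ * _ * _)]mulrA lamS mul1r -ln4.
  by move: exc; rewrite sumE; lra.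
rewrite /sharp_bound; move: fpl gaps total; rewrite -/l_.
by rewrite [m%:R * (_ / beta)]mulrA; lra.
Qed.

Lemma sharp_regret_bound :
  ((1 - delta)%:E <= P [set w | (total_regret w <= sharp_bound)%R])%E.
Proof.
have mgood : measurable [set w | (total_regret w <= sharp_bound)%R].
  by apply: measurable_setb; apply: measurable_fun_ler => //; exact: measurable_total_regret.
have [T2|T2] := leqP T 2.
  rewrite (_ : [set w | _] = setT).
    by rewrite [X in (_ <= X)%E](probability_setT P) lee_fin gerBl ltW.
  apply/seteqP; split => // w _ /=.
  exact: le_trans (total_regret_le_trivial w) (sharp_bound_short T2).
pose bad (k : option 'I_d) := if k is Some i
  then [set w | (ln (5 * d%:R / delta) <= \sum_(t < T) est_gap i t w (choices t w))%R]
  else [set w | (ln (5 / (4 * delta)) <= \sum_(t < T) tilted_excess t w (choices t w))%R].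
have mbad k : measurable (bad k).
  case: k => [i|] /=; apply: measurable_setb; apply: measurable_fun_ler => //.
    have mxi t a : (t < T)%N -> _ := @est_gap_measurable i t a.
    exact: (sub_algebra_fun (process_measurable henv_meas mxi (leqnn T))).
  have mxi t a : (t < T)%N -> _ := @tilted_excess_measurable t a.
  exact: (sub_algebra_fun (process_measurable henv_meas mxi (leqnn T))).
have Pbad : (P [set w | exists k, bad k w] <= delta%:E)%E.
  apply: le_trans (probability_exists_le mbad) _.
  rewrite (bigD1 None)//= (reindex_omap Some id)/=; last by case.
  apply: (@le_trans _ _ ((4 * delta / 5)%:E + \sum_(i < d) (delta / (5 * d%:R))%:E)%E).
    apply: leeD; first exact: tilted_excess_tail.
    rewrite (eq_bigl xpredT) => [|i]; last by rewrite eqxx.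
    by apply: lee_sum => i _; exact: est_gap_tail.
  rewrite sumEFin -EFinD lee_fin sumr_const card_ord -[X in _ + X]mulr_natr.
  rewrite le_eqVlt; apply/orP; left; apply/eqP; field.
  by rewrite pnatr_eq0 -lt0n d_gt0.
have mB : measurable [set w | exists k, bad k w] by exact: measurable_exists_fin.
apply: (@le_trans _ _ (P (~` [set w | exists k, bad k w]))).
  by rewrite probability_setC// EFinB leeB.
apply: le_measure; rewrite ?inE//; first exact: measurableC.
move=> w /= nbad; apply: total_regret_le_sharp => // [i|]; rewrite ltNge; apply/negP => h.
  by apply: nbad; exists (Some i).
by apply: nbad; exists None.
Qed.

End regret_bound.

(** * Comparison with the two stated bounds *)

Section comparison.
Context {R : realType} {m d T M : nat}.
Variables (delta eta beta : R).
Hypothesis m_gt0 : (0 < m)%N.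
Hypothesis m_le_d : (m <= d)%N.
Hypothesis T_gt0 : (0 < T)%N.
Hypothesis M_gt0 : (0 < M)%N.
Hypothesis delta_gt0 : 0 < delta.
Hypothesis delta_lt1 : delta < 1.
Hypothesis eta_gt0 : 0 < eta.
Hypothesis beta_gt0 : 0 < beta.

Local Notation sharp := (@sharp_bound R m d T M delta eta beta).

Lemma sharp_le_general : sharp <=
      m%:R * (ln (d%:R / m%:R) + 1) / eta
      + eta * (M%:R * m%:R * Num.sqrt (2 * T%:R * ln (5 / delta))
               + 2 * m%:R * d%:R * Num.sqrt (T%:R * ln (5 / delta))
               + 2 * m%:R * d%:R * T%:R)
      + d%:R * T%:R / (expR 1 * M%:R)
      + beta * (M%:R * Num.sqrt (2 * m%:R * T%:R * ln (5 / delta))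
                + 2 * d%:R * Num.sqrt (T%:R * ln (5 / delta))
                + 2 * d%:R * T%:R)
      + m%:R * ln (5 * d%:R / delta) / beta
      + m%:R * Num.sqrt (2 * (expR 1 - 2) * T%:R) * ln (5 / delta)
      + Num.sqrt (8 * T%:R * ln (5 / delta))
      + Num.sqrt (2 * (expR 1 - 2) * T%:R).
Proof.
rewrite /sharp_bound /drift.
(* The terms [h1] to [h5] are what the stated bound has beyond the sharp one. *)
have h1 : 0 <= eta * (M%:R * m%:R * Num.sqrt (2 * T%:R * ln (5 / delta))
               + 2 * m%:R * d%:R * Num.sqrt (T%:R * ln (5 / delta))).
  by rewrite mulr_ge0 ?(ltW eta_gt0)// addr_ge0// !mulr_ge0// sqrtr_ge0.
have h2 : 0 <= beta * (M%:R * Num.sqrt (2 * m%:R * T%:R * ln (5 / delta))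
                + 2 * d%:R * Num.sqrt (T%:R * ln (5 / delta))).
  by rewrite mulr_ge0 ?(ltW beta_gt0)// addr_ge0// !mulr_ge0// sqrtr_ge0.
have h3 : 0 <= beta * (d%:R * T%:R) by rewrite !mulr_ge0// ltW.
have h4 := sqrtr_ge0 (8 * T%:R * ln (5 / delta)).
have h5 := sqrtr_ge0 (2 * (expR 1 - 2) * T%:R : R).
set X := (expR 1 * M%:R)^-1.
lra.
Qed.

Lemma sharp_le_tuned :
   M%:Z = Num.ceil (Num.sqrt (d%:R * T%:R / m%:R : R)) ->
   beta = Num.sqrt (m%:R / (d%:R * T%:R)) ->
   eta = Num.sqrt ((ln (d%:R / m%:R) + 1) / (d%:R * T%:R)) ->
  sharp <=
      3 * m%:R * Num.sqrt (d%:R * T%:R * (ln (d%:R / m%:R) + 1))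
      + Num.sqrt (m%:R * d%:R * T%:R) * (ln (5 * d%:R / delta) + 2)
      + Num.sqrt (2 * m%:R * T%:R * ln (5 / delta))
        * (Num.sqrt (ln (d%:R / m%:R) + 1) + 1)
      + 12 / 10 * m%:R * Num.sqrt T%:R * ln (5 / delta)
      + Num.sqrt T%:R * (Num.sqrt (8 * ln (5 / delta)) + 12 / 10)
      + 2 * Num.sqrt (d%:R * ln (5 / delta))
        * (m%:R * Num.sqrt (ln (d%:R / m%:R) + 1) + Num.sqrt m%:R).
Proof.
move=> hM hbeta heta; rewrite /sharp_bound /drift.
have m0 : 0 < m%:R :> R by rewrite ltr0n.
have d0 : 0 < d%:R :> R by rewrite ltr0n; exact: leq_trans m_le_d.
have T0 : 0 < T%:R :> R by rewrite ltr0n.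
set Lam := ln (d%:R / m%:R) + 1.
have Lam0 : 0 < Lam.
  by rewrite ltr_wpDl// ln_ge0// ler_pdivlMr// mul1r ler_nat.
(* In terms of [D], [sm] and [sL] the parameters are [beta = sm / D] and [eta = sL / D], and the
   main terms become multiples of [m * D * sL] and [sm * D]. *)
set D := Num.sqrt (d%:R * T%:R : R).
have D0 : 0 < D by rewrite sqrtr_gt0 mulr_gt0.
have DD : D * D = d%:R * T%:R by rewrite -expr2 sqr_sqrtr// mulr_ge0// ltW.
set sm := Num.sqrt (m%:R : R).
have sm0 : 0 < sm by rewrite sqrtr_gt0.
have smm : sm * sm = m%:R by rewrite -expr2 sqr_sqrtr// ltW.
set sL := Num.sqrt Lam.
have sL0 : 0 < sL by rewrite sqrtr_gt0.
have sLL : sL * sL = Lam by rewrite -expr2 sqr_sqrtr// ltW.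
have betaE : beta = sm / D by rewrite hbeta sqrtrM ?ltW// sqrtrV// mulr_ge0 ?ltW.
have etaE : eta = sL / D by rewrite heta sqrtrM ?ltW// sqrtrV// mulr_ge0 ?ltW.
have -> : Num.sqrt (d%:R * T%:R * Lam) = D * sL by rewrite sqrtrM// mulr_ge0 ?ltW.
have -> : Num.sqrt (m%:R * d%:R * T%:R : R) = sm * D by rewrite -mulrA sqrtrM// ltW.
have MD : D / sm <= M%:R.
  have -> : D / sm = Num.sqrt (d%:R * T%:R / m%:R).
    by rewrite sqrtrM ?mulr_ge0 ?ltW// sqrtrV// ltW.
  have := ceil_ge (Num.sqrt (d%:R * T%:R / m%:R : R)).
  by rewrite -hM.
have t1 : m%:R * Lam / eta = m%:R * (D * sL).
  by rewrite etaE -sLL; field; rewrite !gt_eqF.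
have t2 : T%:R * (eta * (2 * m%:R * d%:R)) = 2 * m%:R * (D * sL).
  rewrite etaE (_ : T%:R * (sL / D * (2 * m%:R * d%:R)) = sL / D * 2 * m%:R * (d%:R * T%:R)).
    by rewrite -DD; field; rewrite gt_eqF.
  by ring.
have t3 : T%:R * (beta * d%:R) = sm * D.
  rewrite betaE (_ : T%:R * (sm / D * d%:R) = sm / D * (d%:R * T%:R)); last by ring.
  by rewrite -DD; field; rewrite gt_eqF.
have t4 x : m%:R * x / beta = sm * D * x.
  by rewrite betaE -smm; field; rewrite !gt_eqF.
(* The ceiling gives [M >= D / sm]; the further factor [1 / e] is given away. *)
have t5 : T%:R * (d%:R / (expR 1 * M%:R)) <= sm * D.
  have e1 : 1 <= expR 1 :> R by rewrite -[leLHS]expR0 ler_expR.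
  have M0 : 0 < M%:R :> R by rewrite ltr0n.
  rewrite mulrA [T%:R * _]mulrC -DD ler_pdivrMr ?mulr_gt0 ?expR_gt0//.
  have h1 : D <= M%:R * sm by rewrite -ler_pdivrMr.
  have h2 : D * D <= D * (M%:R * sm) by rewrite ler_wpM2l// ltW.
  have h3 : 0 <= (expR 1 - 1) * (sm * D * M%:R).
    by rewrite mulr_ge0 ?subr_ge0// !mulr_ge0// ltW.
  lra.
have t6 : Num.sqrt (2 * (expR 1 - 2) * T%:R) <= 12 / 10 * Num.sqrt T%:R :> R.
  have e1 := @expR1_ge R; have e2 := @expR1_le R.
  have sT := sqr_sqrtr (ltW T0).
  have sT0 := sqrtr_ge0 (T%:R : R).
  have b0 : 0 <= 12 / 10 * Num.sqrt (T%:R : R) by apply: mulr_ge0; [lra|].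
  have a0 : 0 <= 2 * (expR 1 - 2) * T%:R :> R by apply: mulr_ge0; [lra|exact: ltW].
  rewrite -(@ler_pXn2r _ 2) ?nnegrE ?sqrtr_ge0 ?b0// sqr_sqrtr// exprMn sT.
  have : 0 <= (68 / 25 - expR 1) * T%:R :> R by apply: mulr_ge0; [lra|exact: ltW].
  by lra.
have L0 : 0 <= ln (5 / delta).
  rewrite ln_ge0// ler_pdivlMr// mul1r; apply: (le_trans (ltW delta_lt1)); lra.
have t7 : m%:R * Num.sqrt (2 * (expR 1 - 2) * T%:R) * ln (5 / delta) <=
    12 / 10 * m%:R * Num.sqrt T%:R * ln (5 / delta).
  apply: ler_wpM2r => //.
  by have := ler_wpM2l (ltW m0) t6; lra.
have p1 : 0 <= Num.sqrt (2 * m%:R * T%:R * ln (5 / delta)) * (sL + 1).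
  by apply: mulr_ge0; [exact: sqrtr_ge0|lra].
have p2 : 0 <= Num.sqrt T%:R * (Num.sqrt (8 * ln (5 / delta)) + 12 / 10) :> R.
  apply: mulr_ge0; first exact: sqrtr_ge0.
  by have := sqrtr_ge0 (8 * ln (5 / delta)); lra.
have p3 : 0 <= 2 * Num.sqrt (d%:R * ln (5 / delta)) * (m%:R * sL + sm).
  apply: mulr_ge0; first by have := sqrtr_ge0 (d%:R * ln (5 / delta)); lra.
  by have := mulr_ge0 (ltW m0) (ltW sL0); lra.
have t8 : T%:R * (d%:R / (expR 1 * M%:R) + beta * d%:R + eta * (2 * m%:R * d%:R))
    <= sm * D + sm * D + 2 * m%:R * (D * sL).
  by rewrite 2!mulrDr t2 t3 !lerD2r.
rewrite t1 t4; lra.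
Qed.

End comparison.

Theorem theorem2 (R : realType) (m d T : nat)
  (hm : (1 <= m)%N) (hmd : (m <= d)%N) (hT : (1 <= T)%N)
  (S : {set action d}) (hS0 : S != finset.set0)
  (hSm : forall v : action d, v \in S -> (\sum_(i < d) v i <= m)%N)
  (delta : R) (hdelta0 : 0 < delta) (hdelta1 : delta < 1)
  (eta beta : R) (M : nat)
  (heta : 0 < eta) (hbeta : 0 < beta) (hM : (1 <= M)%N)
  (dO : measure_display) (Omega : measurableType dO) (P : probability Omega R)
  (* the learner's randomness *)
  (Z : nat -> option 'I_M -> 'I_d -> {RV P >-> R})
  (hZexp : forall (t : 'I_T) (k : option 'I_M) (i : 'I_d) (A : set R),
     measurable A -> distribution P (Z t k i) A = exponential_prob 1 A)
  (* a non-oblivious environment, possibly with private randomness U *)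
  (dY : measure_display) (Y : measurableType dY) (U : {RV P >-> Y})
  (env : Y -> seq (action d) -> 'I_d -> R)
  (henv_meas : forall (h : seq (action d)) (i : 'I_d),
     measurable_fun setT (fun y => env y h i))
  (henv01 : forall (y : Y) (h : seq (action d)) (i : 'I_d),
     0 <= env y h i <= 1)
  (hindep : mutually_independent P
     (fun j : option ('I_T * option 'I_M * 'I_d) =>
        match j with
        | Some (t, k, i) => sigma_of (Z t k i)
        | None => sigma_of U
        end)) :
  let R_T (w : Omega) : R :=
    regret S eta beta (env (U w)) (fun t k i => Z t k i w) T in
  ((1 - delta)%:E <= P [set w | (R_T w <=
      m%:R * (ln (d%:R / m%:R) + 1) / eta
      + eta * (M%:R * m%:R * Num.sqrt (2 * T%:R * ln (5 / delta))
               + 2 * m%:R * d%:R * Num.sqrt (T%:R * ln (5 / delta))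
               + 2 * m%:R * d%:R * T%:R)
      + d%:R * T%:R / (expR 1 * M%:R)
      + beta * (M%:R * Num.sqrt (2 * m%:R * T%:R * ln (5 / delta))
                + 2 * d%:R * Num.sqrt (T%:R * ln (5 / delta))
                + 2 * d%:R * T%:R)
      + m%:R * ln (5 * d%:R / delta) / beta
      + m%:R * Num.sqrt (2 * (expR 1 - 2) * T%:R) * ln (5 / delta)
      + Num.sqrt (8 * T%:R * ln (5 / delta))
      + Num.sqrt (2 * (expR 1 - 2) * T%:R))%R])%E
  /\
  (M%:Z = Num.ceil (Num.sqrt (d%:R * T%:R / m%:R : R)) ->
   beta = Num.sqrt (m%:R / (d%:R * T%:R)) ->
   eta = Num.sqrt ((ln (d%:R / m%:R) + 1) / (d%:R * T%:R)) ->
   ((1 - delta)%:E <= P [set w | (R_T w <=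
      3 * m%:R * Num.sqrt (d%:R * T%:R * (ln (d%:R / m%:R) + 1))
      + Num.sqrt (m%:R * d%:R * T%:R) * (ln (5 * d%:R / delta) + 2)
      + Num.sqrt (2 * m%:R * T%:R * ln (5 / delta))
        * (Num.sqrt (ln (d%:R / m%:R) + 1) + 1)
      + 12 / 10 * m%:R * Num.sqrt T%:R * ln (5 / delta)
      + Num.sqrt T%:R * (Num.sqrt (8 * ln (5 / delta)) + 12 / 10)
      + 2 * Num.sqrt (d%:R * ln (5 / delta))
        * (m%:R * Num.sqrt (ln (d%:R / m%:R) + 1) + Num.sqrt m%:R))%R])%E).
Proof.
move=> R_T.
have sharp := sharp_regret_bound hm hmd hT hS0 hSm hdelta0 hdelta1 heta hbeta hM hZexp
  henv_meas henv01 hindep.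
have mono c : @sharp_bound R m d T M delta eta beta <= c ->
    ((1 - delta)%:E <= P [set w | (R_T w <= c)%R])%E.
  move=> sc; apply: le_trans sharp _.
  have mR c' : measurable [set w | (R_T w <= c')%R].
    apply: measurable_setb; apply: measurable_fun_ler => //.
    exact: measurable_total_regret.
  by apply: le_measure; rewrite ?inE// => w /= /le_trans; apply.
split; first by apply: mono; exact: sharp_le_general.
by move=> hM' hb he; apply: mono; exact: sharp_le_tuned.
Qed.
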